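(* Let $R$ be a commutative ring with nilradical $\mathfrak N$. The following are equivalent: (i) $R/\mathfrak N$ is absolutely flat; (ii) every flat epimorphism of commutative rings $\phi:R\to S$ is surjective; (iii) for every prime ideal $\mathfrak p$ of $R$, the canonical map $R\to R_{\mathfrak p}$ is surjective; (iv) every prime ideal of $R$ is maximal; (v) the patch topology and the Zariski topology on $\mathrm{Spec}(R)$ coincide; (vi) $\mathrm{Spec}(R)$ with the Zariski topology is Hausdorff; (vii) every prime ideal of $R$ is minimal; (viii) $\mathrm{Spec}(R)$ with the flat topology is Hausdorff; (ix) the patch topology and the flat topology on $\mathrm{Spec}(R)$ coincide.
   Context: A commutative ring is absolutely flat if every module over it is flat. Epimorphism means epimorphism in the category of commutative rings. The flat topology on $\mathrm{Spec}(R)$ is the topology having as a basis of open sets the sets $V(I)=\{\mathfrak p\in\mathrm{Spec}(R):I\subseteq\mathfrak p\}$ with $I$ ranging over finitely generated ideals of $R$ (Hochster's inverse topology). The patch (constructible) topology on $\mathrm{Spec}(R)$ is the topology generated by the sets $D(f)=\{\mathfrak p: f\notin\mathfrak p\}$ and $V(f)=\{\mathfrak p: f\in\mathfrak p\}$ for $f\in R$; it is the coarsest topology finer than both the Zariski and the flat topology. *)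

(* Defs.v *)
From HB Require Import structures.
From mathcomp Require Import all_boot all_order all_algebra.
From Stdlib Require List.
Set Implicit Arguments. Unset Strict Implicit. Unset Printing Implicit Defensive.
Import GRing.Theory.
Local Open Scope ring_scope.

Section Defs.
Variable R : comPzRingType.

Definition bilinear_act (M : zmodType) (act : R -> M -> M)
  (N P : lmodType R) (b : M -> N -> P) : Prop :=
  [/\ forall m1 m2 n, b (m1 + m2) n = b m1 n + b m2 n,
      forall m n1 n2, b m (n1 + n2) = b m n1 + b m n2,
      forall r m n, b (act r m) n = r *: b m n
    & forall r m n, b m (r *: n) = r *: b m n].

(* sum_i m_i (x) n_i = 0 in M (x)_R N  (universal property of the tensor
   product: an element is zero iff every bilinear map kills it). *)
Definition tensor_zero (M : zmodType) (act : R -> M -> M) (N : lmodType R)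
  (s : seq (M * N)) : Prop :=
  forall (P : lmodType R) (b : M -> N -> P), bilinear_act act b ->
    \sum_(x <- s) b x.1 x.2 = 0.

Definition flat_act (M : zmodType) (act : R -> M -> M) : Prop :=
  forall (N N' : lmodType R) (f : {linear N -> N'}), injective f ->
  forall s : seq (M * N),
    tensor_zero act [seq (x.1, f x.2) | x <- s] -> tensor_zero act s.

Definition flat_module (M : lmodType R) : Prop := flat_act (fun r (m : M) => r *: m).

End Defs.

Definition absolutely_flat (R : comPzRingType) : Prop :=
  forall M : lmodType R, flat_module M.

Definition nilpotent (R : comPzRingType) (x : R) : Prop := exists n, x ^+ n = 0.

Definition reduced_quotient_absolutely_flat (R : comPzRingType) : Prop :=
  forall (Q : comPzRingType) (pi : {rmorphism R -> Q}),
    (forall q : Q, exists r, pi r = q) ->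
    (forall r, pi r = 0 <-> nilpotent r) ->
    absolutely_flat Q.

Definition flat_ringmorph (R S : comPzRingType) (phi : {rmorphism R -> S}) : Prop :=
  flat_act (fun r (s : S) => phi r * s).

Definition ring_epi (R S : comPzRingType) (phi : {rmorphism R -> S}) : Prop :=
  forall (T : comPzRingType) (g h : {rmorphism S -> T}),
    (forall r, g (phi r) = h (phi r)) -> forall s, g s = h s.

Section Spec.
Variable R : comPzRingType.

Definition ideal (I : R -> Prop) : Prop :=
  [/\ I 0, (forall x y, I x -> I y -> I (x - y)) & (forall r x, I x -> I (r * x))].

Definition prime_ideal (p : R -> Prop) : Prop :=
  [/\ ideal p, ~ p 1 & forall a b, p (a * b) -> p a \/ p b].

Definition maximal_ideal (p : R -> Prop) : Prop :=
  [/\ ideal p, ~ p 1 &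
     forall J : R -> Prop, ideal J -> ~ J 1 -> (forall x, p x -> J x) -> forall x, J x -> p x].

Definition minimal_prime (p : R -> Prop) : Prop :=
  prime_ideal p /\
  forall q : R -> Prop, prime_ideal q -> (forall x, q x -> p x) -> forall x, p x -> q x.

(* Localization R_p: elements are classes of fractions r/s (s notin p) modulo
   r/s ~ r'/s' iff t (r s' - r' s) = 0 for some t notin p; the canonical map
   is r |-> r/1. *)
Definition loc_equiv (p : R -> Prop) (x y : R * R) : Prop :=
  exists t, ~ p t /\ t * (x.1 * y.2 - y.1 * x.2) = 0.

Definition loc_map_surjective (p : R -> Prop) : Prop :=
  forall x : R * R, ~ p x.2 -> exists a : R, loc_equiv p x (a, 1).

Definition Spec := {p : R -> Prop | prime_ideal p}.

Definition same_point (x y : Spec) : Prop := forall r, proj1_sig x r <-> proj1_sig y r.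

Definition subset_Spec (A B : Spec -> Prop) : Prop := forall x, A x -> B x.

Definition DD (f : R) (A : Spec -> Prop) : Prop := forall x, A x <-> ~ proj1_sig x f.
Definition VV (f : R) (A : Spec -> Prop) : Prop := forall x, A x <-> proj1_sig x f.

Definition zariski_open (U : Spec -> Prop) : Prop :=
  exists E : R -> Prop, forall x, U x <-> ~ (forall r, E r -> proj1_sig x r).

Definition basis_open (B : (Spec -> Prop) -> Prop) (U : Spec -> Prop) : Prop :=
  forall x, U x -> exists A, [/\ B A, A x & subset_Spec A U].

Definition subbasis_open (B : (Spec -> Prop) -> Prop) (U : Spec -> Prop) : Prop :=
  forall x, U x -> exists l : list (Spec -> Prop),
    [/\ forall A, List.In A l -> B A,
        forall A, List.In A l -> A x
      & forall y, (forall A, List.In A l -> A y) -> U y].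

(* flat topology: basis V(I), I finitely generated (I generated by the list l) *)
Definition flat_basic (A : Spec -> Prop) : Prop :=
  exists l : seq R, forall x, A x <-> (forall r, r \in l -> proj1_sig x r).
Definition flat_open : (Spec -> Prop) -> Prop := basis_open flat_basic.

Definition patch_basic (A : Spec -> Prop) : Prop := exists f, DD f A \/ VV f A.
Definition patch_open : (Spec -> Prop) -> Prop := subbasis_open patch_basic.

Definition same_topology (O1 O2 : (Spec -> Prop) -> Prop) : Prop :=
  forall U, O1 U <-> O2 U.

Definition hausdorff (O : (Spec -> Prop) -> Prop) : Prop :=
  forall x y : Spec, ~ same_point x y ->
    exists U V, [/\ O U, O V, U x, V y & forall z, ~ (U z /\ V z)].

End Spec.

(* Main.v *)
(* All nine conditions are equivalent to R being pi-regular: for every f there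
   are n and a with f^n (1 - f a) = 0. In that case f and 1 - f a are
   complementary on Spec(R), which settles the topological conditions;
   conversely, if all primes are maximal, a prime avoiding the multiplicative set
   {f^n (1 - f a)} cannot exist, so this set contains 0.

   (i): R/N is absolutely flat iff it is von Neumann regular. Flatness of M over a
   von Neumann regular ring is shown by extending a bilinear map M x N -> P to a
   finitely generated enlargement of N one generator at a time, embedding P in a
   larger module at each step; finitely many generators suffice because an
   element vanishing in M (x) N' already vanishes over a finitely generated
   submodule.

   (ii): R -> R_p is a flat epimorphism. For a flat epimorphism phi : R -> S and s in S,
   the ideal I of the r with phi(r) s in phi(R) satisfies I S = S; pi-regularity
   then yields v with 1 - v in I and phi(v) nilpotent, whence s in phi(R). *)
Require Import Defs.
From HB Require Import structures.
From mathcomp Require Import all_boot all_order all_algebra.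
From mathcomp Require Import boolp classical_sets ring.
Set Implicit Arguments. Unset Strict Implicit. Unset Printing Implicit Defensive.
Import GRing.Theory.
Local Open Scope quotient_scope.
Local Open Scope ring_scope.

#[local] Obligation Tactic := idtac.

(** * Quotients by setoid equalities *)

(** Module quotients, tensor products, localizations and the reduced ring are all obtained from
    carriers, such as lists or pairs, on which the group laws hold only up to an equivalence; one
    quotient construction serves them all. *)
Record zmod_setoid := ZmodSetoid {
  zs_sort :> Type;
  zs_eq : zs_sort -> zs_sort -> Prop;
  zs_refl : forall x, zs_eq x x;
  zs_sym : forall x y, zs_eq x y -> zs_eq y x;
  zs_trans : forall x y z, zs_eq x y -> zs_eq y z -> zs_eq x z;
  zs_zero : zs_sort;
  zs_opp : zs_sort -> zs_sort;
  zs_add : zs_sort -> zs_sort -> zs_sort;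
  zs_opp_eq : forall x y, zs_eq x y -> zs_eq (zs_opp x) (zs_opp y);
  zs_add_eq : forall x x' y y',
    zs_eq x x' -> zs_eq y y' -> zs_eq (zs_add x y) (zs_add x' y');
  zs_addA : forall x y z, zs_eq (zs_add x (zs_add y z)) (zs_add (zs_add x y) z);
  zs_addC : forall x y, zs_eq (zs_add x y) (zs_add y x);
  zs_add0 : forall x, zs_eq (zs_add zs_zero x) x;
  zs_addN : forall x, zs_eq (zs_add (zs_opp x) x) zs_zero }.

Section ZmodQuotient.
Variable Z : zmod_setoid.

(** [{classic Z}] supplies the choice structure that [{eq_quot _}] requires of its carrier. *)
Let zrel (x y : {classic Z}) : bool := `[< zs_eq x y >].

Let zrel_refl : reflexive zrel.
Proof. by move=> x; apply/asboolP/zs_refl. Qed.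

Let zrel_sym : symmetric zrel.
Proof. by move=> x y; apply/asboolP/asboolP; apply: zs_sym. Qed.

Let zrel_trans : transitive zrel.
Proof.
by move=> y x z /asboolP xy /asboolP yz; apply/asboolP/(zs_trans xy yz).
Qed.

Let zequiv := EquivRel zrel zrel_refl zrel_sym zrel_trans.

Definition zquot : Type := {eq_quot zequiv}.
HB.instance Definition _ := Choice.on zquot.

Definition zcls (x : Z) : zquot := \pi_({eq_quot zequiv}) (x : {classic Z}).
Definition zrep (q : zquot) : Z := repr q.

Lemma zrepK q : zcls (zrep q) = q.
Proof. exact: reprK. Qed.

Lemma zclsP x y : zcls x = zcls y <-> zs_eq x y.
Proof. by split=> [/eqmodP/asboolP|xy]; last apply/eqmodP/asboolP. Qed.

Lemma zrep_cls x : zs_eq (zrep (zcls x)) x.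
Proof. by apply/zclsP; rewrite zrepK. Qed.

Lemma zquotW (P : zquot -> Prop) : (forall x, P (zcls x)) -> forall q, P q.
Proof. by move=> Px q; rewrite -(zrepK q). Qed.

Let qadd p q := zcls (zs_add (zrep p) (zrep q)).
Let qopp p := zcls (zs_opp (zrep p)).

Let qaddE x y : qadd (zcls x) (zcls y) = zcls (zs_add x y).
Proof. by apply/zclsP/zs_add_eq; apply: zrep_cls. Qed.

Let qoppE x : qopp (zcls x) = zcls (zs_opp x).
Proof. by apply/zclsP/zs_opp_eq; apply: zrep_cls. Qed.

Let qaddA : associative qadd.
Proof.
elim/zquotW=> x; elim/zquotW=> y; elim/zquotW=> z.
by rewrite !qaddE; apply/zclsP/zs_addA.
Qed.

Let qaddC : commutative qadd.
Proof.
by elim/zquotW=> x; elim/zquotW=> y; rewrite !qaddE; apply/zclsP/zs_addC.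
Qed.

Let qadd0 : left_id (zcls (zs_zero Z)) qadd.
Proof. by elim/zquotW=> x; rewrite qaddE; apply/zclsP/zs_add0. Qed.

Let qaddN : left_inverse (zcls (zs_zero Z)) qopp qadd.
Proof. by elim/zquotW=> x; rewrite qoppE qaddE; apply/zclsP/zs_addN. Qed.

HB.instance Definition _ := GRing.isZmodule.Build zquot qaddA qaddC qadd0 qaddN.

Lemma zcls0 : zcls (zs_zero Z) = 0. Proof. by []. Qed.
Lemma zclsD x y : zcls (zs_add x y) = zcls x + zcls y.
Proof. by rewrite -qaddE. Qed.

Lemma zcls_eq0 x : zcls x = 0 <-> zs_eq x (zs_zero Z).
Proof. by rewrite -zcls0 zclsP. Qed.

End ZmodQuotient.

Record lmod_setoid (R : pzRingType) := LmodSetoid {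
  ls_zmod :> zmod_setoid;
  ls_scale : R -> ls_zmod -> ls_zmod;
  ls_scale_eq : forall r x y, zs_eq x y -> zs_eq (ls_scale r x) (ls_scale r y);
  ls_scaleA : forall a b x,
    zs_eq (ls_scale a (ls_scale b x)) (ls_scale (a * b) x);
  ls_scale1 : forall x, zs_eq (ls_scale 1 x) x;
  ls_scaleDr : forall a x y,
    zs_eq (ls_scale a (zs_add x y)) (zs_add (ls_scale a x) (ls_scale a y));
  ls_scaleDl : forall a b x,
    zs_eq (ls_scale (a + b) x) (zs_add (ls_scale a x) (ls_scale b x)) }.

Section LmodQuotient.
Variables (R : pzRingType) (L : lmod_setoid R).

Definition lquot : Type := zquot L.
HB.instance Definition _ := GRing.Zmodule.on lquot.
Definition lcls (x : L) : lquot := zcls x.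
Definition lrep (q : lquot) : L := zrep q.

Lemma lquotW (P : lquot -> Prop) : (forall x, P (lcls x)) -> forall q, P q.
Proof. exact: zquotW. Qed.
Lemma lclsD x y : lcls (zs_add x y) = lcls x + lcls y.
Proof. exact: zclsD. Qed.

Let qscale a (q : lquot) : lquot := lcls (ls_scale a (lrep q)).

Let qscaleE a x : qscale a (lcls x) = lcls (ls_scale a x).
Proof. by apply/zclsP/ls_scale_eq/zrep_cls. Qed.

Let qscaleA a b q : qscale a (qscale b q) = qscale (a * b) q.
Proof. by elim/lquotW: q => x; rewrite !qscaleE; apply/zclsP/ls_scaleA. Qed.

Let qscale1 : left_id 1 qscale.
Proof. by elim/lquotW=> x; rewrite qscaleE; apply/zclsP/ls_scale1. Qed.

Let qscaleDr : right_distributive qscale +%R.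
Proof.
move=> a; elim/lquotW=> x; elim/lquotW=> y.
by rewrite -lclsD !qscaleE -lclsD; apply/zclsP/ls_scaleDr.
Qed.

Let qscaleDl q : {morph qscale^~ q : a b / a + b}.
Proof.
elim/lquotW: q => x a b.
by rewrite !qscaleE -lclsD; apply/zclsP/ls_scaleDl.
Qed.

HB.instance Definition _ :=
  GRing.Zmodule_isLmodule.Build R lquot qscaleA qscale1 qscaleDr qscaleDl.

Lemma lrepK q : lcls (lrep q) = q. Proof. exact: zrepK. Qed.
Lemma lclsP x y : lcls x = lcls y <-> zs_eq x y. Proof. exact: zclsP. Qed.
Lemma lclsZ a x : lcls (ls_scale a x) = a *: lcls x.
Proof. by rewrite -qscaleE. Qed.
Lemma lcls_eq0 x : lcls x = 0 <-> zs_eq x (zs_zero L).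
Proof. exact: zcls_eq0. Qed.

End LmodQuotient.

Record ring_setoid := RingSetoid {
  rs_zmod :> zmod_setoid;
  rs_one : rs_zmod;
  rs_mul : rs_zmod -> rs_zmod -> rs_zmod;
  rs_mul_eq : forall x x' y y',
    zs_eq x x' -> zs_eq y y' -> zs_eq (rs_mul x y) (rs_mul x' y');
  rs_mulA : forall x y z, zs_eq (rs_mul x (rs_mul y z)) (rs_mul (rs_mul x y) z);
  rs_mulC : forall x y, zs_eq (rs_mul x y) (rs_mul y x);
  rs_mul1 : forall x, zs_eq (rs_mul rs_one x) x;
  rs_mulDl : forall x y z,
    zs_eq (rs_mul (zs_add x y) z) (zs_add (rs_mul x z) (rs_mul y z)) }.

Section RingQuotient.
Variable A : ring_setoid.

Definition rquot : Type := zquot A.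
HB.instance Definition _ := GRing.Zmodule.on rquot.
Definition rcls (x : A) : rquot := zcls x.
Definition rrep (q : rquot) : A := zrep q.

Lemma rquotW (P : rquot -> Prop) : (forall x, P (rcls x)) -> forall q, P q.
Proof. exact: zquotW. Qed.
Lemma rclsD x y : rcls (zs_add x y) = rcls x + rcls y.
Proof. exact: zclsD. Qed.

Let qmul (p q : rquot) : rquot := rcls (rs_mul (rrep p) (rrep q)).

Let qmulE x y : qmul (rcls x) (rcls y) = rcls (rs_mul x y).
Proof. by apply/zclsP/rs_mul_eq; apply: zrep_cls. Qed.

Let qmulA : associative qmul.
Proof.
elim/rquotW=> x; elim/rquotW=> y; elim/rquotW=> z.
by rewrite !qmulE; apply/zclsP/rs_mulA.
Qed.

Let qmulC : commutative qmul.
Proof.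
by elim/rquotW=> x; elim/rquotW=> y; rewrite !qmulE; apply/zclsP/rs_mulC.
Qed.

Let qmul1 : left_id (rcls (rs_one A)) qmul.
Proof. by elim/rquotW=> x; rewrite qmulE; apply/zclsP/rs_mul1. Qed.

Let qmulDl : left_distributive qmul +%R.
Proof.
elim/rquotW=> x; elim/rquotW=> y; elim/rquotW=> z.
by rewrite -rclsD !qmulE -rclsD; apply/zclsP/rs_mulDl.
Qed.

HB.instance Definition _ :=
  GRing.Zmodule_isComPzRing.Build rquot qmulA qmulC qmul1 qmulDl.

Lemma rclsP x y : rcls x = rcls y <-> zs_eq x y. Proof. exact: zclsP. Qed.
Lemma rrep_cls x : zs_eq (rrep (rcls x)) x. Proof. exact: zrep_cls. Qed.
Lemma rclsM x y : rcls (rs_mul x y) = rcls x * rcls y.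
Proof. by rewrite -qmulE. Qed.
Lemma rcls_eq0 x : rcls x = 0 <-> zs_eq x (zs_zero A).
Proof. exact: zcls_eq0. Qed.

End RingQuotient.

(** * Quotients of modules by submodules *)

Definition submodule (R : pzRingType) (V : lmodType R) (K : V -> Prop) : Prop :=
  [/\ K 0, forall x y, K x -> K y -> K (x - y) & forall a x, K x -> K (a *: x)].

Section Submodule.
Variables (R : pzRingType) (V : lmodType R) (K : V -> Prop).
Hypothesis subK : submodule K.

Lemma submod0 : K 0. Proof. by case: subK. Qed.
Lemma submodB x y : K x -> K y -> K (x - y). Proof. by case: subK => _ + _; apply. Qed.
Lemma submodZ a x : K x -> K (a *: x). Proof. by case: subK => _ _; apply. Qed.
Lemma submodN x : K x -> K (- x).
Proof. by rewrite -scaleN1r; apply: submodZ. Qed.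
Lemma submodD x y : K x -> K y -> K (x + y).
Proof. by move=> Kx /submodN; rewrite -{2}(opprK y); apply: submodB. Qed.

Program Definition quot_zmod_setoid : zmod_setoid :=
  @ZmodSetoid V (fun x y => K (x - y)) _ _ _ 0 -%R +%R _ _ _ _ _ _.
Next Obligation. by move=> x; rewrite /= subrr; apply: submod0. Qed.
Next Obligation. by move=> x y; rewrite /= -[y - x]opprB; apply: submodN. Qed.
Next Obligation. by move=> x y z; rewrite /= -[x - z](subrKA y); apply: submodD. Qed.
Next Obligation. by move=> x y; rewrite /= -opprD; apply: submodN. Qed.
Next Obligation. by move=> x x' y y'; rewrite /= opprD addrACA; apply: submodD. Qed.
Next Obligation. by move=> x y z; rewrite /= addrA subrr; apply: submod0. Qed.
Next Obligation. by move=> x y; rewrite /= (addrC x) subrr; apply: submod0. Qed.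
Next Obligation. by move=> x; rewrite /= add0r subrr; apply: submod0. Qed.
Next Obligation. by move=> x; rewrite /= addNr subrr; apply: submod0. Qed.

Program Definition quot_lmod_setoid : lmod_setoid R :=
  @LmodSetoid R quot_zmod_setoid (fun a x => a *: (x : V)) _ _ _ _ _.
Next Obligation. by move=> r x y; rewrite /= -scalerBr; apply: submodZ. Qed.
Next Obligation. by move=> a b x; rewrite /= scalerA subrr; apply: submod0. Qed.
Next Obligation. by move=> x; rewrite /= scale1r subrr; apply: submod0. Qed.
Next Obligation. by move=> a x y; rewrite /= scalerDr subrr; apply: submod0. Qed.
Next Obligation. by move=> a b x; rewrite /= scalerDl subrr; apply: submod0. Qed.

Definition quot : lmodType R := lquot quot_lmod_setoid.
Definition qcls (x : V) : quot := @lcls _ quot_lmod_setoid x.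
Definition qrep (q : quot) : V := lrep q.

Lemma qclsP x y : qcls x = qcls y <-> K (x - y).
Proof. exact: (@lclsP _ quot_lmod_setoid). Qed.

Lemma qcls_eq0 x : qcls x = 0 <-> K x.
Proof. by rewrite -[X in K X]subr0; apply: qclsP. Qed.

Lemma qcls_is_linear : linear qcls.
Proof.
move=> a x y; transitivity (qcls (a *: x) + qcls y).
  exact: (@lclsD _ quot_lmod_setoid (a *: x) y).
by congr (_ + _); exact: (@lclsZ _ quot_lmod_setoid a x).
Qed.
HB.instance Definition _ := GRing.isLinear.Build R V quot _ qcls qcls_is_linear.

Lemma qrepK q : qcls (qrep q) = q. Proof. exact: lrepK. Qed.

Lemma qrep_cls x : K (qrep (qcls x) - x).
Proof. by apply/qclsP; rewrite qrepK. Qed.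

Lemma qclsW (P : quot -> Prop) : (forall x, P (qcls x)) -> forall q, P q.
Proof. by move=> Px q; rewrite -(qrepK q). Qed.

End Submodule.

(** * Flatness over von Neumann regular rings *)

(** A bilinear map on [M x D] is represented by a total function on [M x N] whose values off [D] are
    unconstrained, so that [D] can grow without a change of type. *)
Definition bilinear_on (R : pzRingType) (M N P : lmodType R) (D : N -> Prop)
  (b : M -> N -> P) : Prop :=
  [/\ forall m1 m2 n, D n -> b (m1 + m2) n = b m1 n + b m2 n,
      forall m n1 n2, D n1 -> D n2 -> b m (n1 + n2) = b m n1 + b m n2,
      forall r m n, D n -> b (r *: m) n = r *: b m n
    & forall r m n, D n -> b m (r *: n) = r *: b m n].

(** * The tensor product as a quotient of formal sums *)

Section FormalTensor.
Variables (R : comPzRingType) (M N : lmodType R).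

(* Equality in [M (x) D] for every submodule [D] containing a finite set [Y]; this is
   equality in [M (x) N], with the finiteness of the relations used built in. *)
Definition tensor_eq (s t : seq (M * N)) : Prop :=
  exists Y : seq N, forall D : N -> Prop, submodule D -> (forall y, y \in Y -> D y) ->
    forall (P : lmodType R) (b : M -> N -> P), bilinear_on D b ->
      \sum_(x <- s) b x.1 x.2 = \sum_(x <- t) b x.1 x.2.

Lemma tensor_eq_eq s t : s = t -> tensor_eq s t.
Proof. by move->; exists [::]. Qed.

Program Definition tensor_zmod_setoid : zmod_setoid :=
  @ZmodSetoid (seq (M * N)) tensor_eq _ _ _ nil
    (fun s => [seq (x.1, - x.2) | x <- s]) cat _ _ _ _ _ _.
Next Obligation. by move=> s; apply: tensor_eq_eq. Qed.
Next Obligation. by move=> s t [Y eqY]; exists Y => D sD DY P b bb; rewrite (eqY D). Qed.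
Next Obligation.
move=> s t u [Y eqY] [Y' eqY']; exists (Y ++ Y') => D sD DY P b bb.
by rewrite (eqY D) ?(eqY' D) // => y yY; apply: DY; rewrite mem_cat yY ?orbT.
Qed.
Next Obligation.
move=> s t [Y eqY]; exists Y => D sD DY P b [b1 b2 b3 b4]; rewrite !big_map /=.
apply: (eqY D sD DY P (fun m n => b m (- n))); split.
- by move=> m1 m2 n Dn; rewrite b1 //; apply: submodN.
- by move=> m n1 n2 D1 D2; rewrite opprD b2 //; apply: submodN.
- by move=> r m n Dn; rewrite b3 //; apply: submodN.
- by move=> r m n Dn; rewrite -scalerN b4 //; apply: submodN.
Qed.
Next Obligation.
move=> s s' t t' [Y eqY] [Y' eqY']; exists (Y ++ Y') => D sD DY P b bb.
rewrite !big_cat /=.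
by rewrite (eqY D) ?(eqY' D) // => y yY; apply: DY; rewrite mem_cat yY ?orbT.
Qed.
Next Obligation. by move=> s t u; apply: tensor_eq_eq; rewrite catA. Qed.
Next Obligation. by move=> s t; exists nil => D _ _ P b _; rewrite !big_cat /= addrC. Qed.
Next Obligation. by move=> s; apply: tensor_eq_eq. Qed.
Next Obligation.
(* The law b(m, -n) = -b(m, n) holds only for n in [D], so the right-hand entries of [s] are put
   into the finite set. *)
move=> s; exists (unzip2 s) => D sD DY P b [b1 b2 b3 b4].
rewrite big_cat big_map big_nil /= -big_split big1_seq //= => -[m n] mn.
have Dn : D n by apply: DY; apply: (map_f snd mn).
by rewrite -scaleN1r b4 // scaleN1r addNr.
Qed.

Program Definition tensor_lmod_setoid : lmod_setoid R :=
  @LmodSetoid R tensor_zmod_setoid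
    (fun r (s : seq (M * N)) => [seq (x.1, r *: x.2) | x <- s]) _ _ _ _ _.
Next Obligation.
move=> r s t [Y eqY]; exists Y => D sD DY P b [b1 b2 b3 b4]; rewrite !big_map /=.
apply: (eqY D sD DY P (fun m n => b m (r *: n))); split.
- by move=> m1 m2 n Dn; rewrite b1 //; apply: submodZ.
- by move=> m n1 n2 D1 D2; rewrite scalerDr b2 //; apply: submodZ.
- by move=> r' m n Dn; rewrite b3 //; apply: submodZ.
- by move=> r' m n Dn; rewrite scalerA mulrC -scalerA b4 //; apply: submodZ.
Qed.
Next Obligation.
move=> a b s; apply: tensor_eq_eq; rewrite -map_comp; apply: eq_map => y /=.
by rewrite scalerA.
Qed.
Next Obligation.
move=> s; apply: tensor_eq_eq; rewrite -[RHS]map_id; apply: eq_map => -[m n] /=.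
by rewrite scale1r.
Qed.
Next Obligation. by move=> a s t; apply: tensor_eq_eq; rewrite map_cat. Qed.
Next Obligation.
move=> a a' s; exists (unzip2 s) => D sD DY P b [b1 b2 b3 b4].
rewrite big_cat !big_map /= -big_split; apply: eq_big_seq => -[m n] mn /=.
have Dn : D n by apply: DY; apply: (map_f snd mn).
by rewrite scalerDl b2 //; apply: submodZ.
Qed.

Definition tensor : lmodType R := lquot tensor_lmod_setoid.
Definition tpure (m : M) (n : N) : tensor := @lcls _ tensor_lmod_setoid [:: (m, n)].

Lemma tpure_bilinear : bilinear_act (fun r (m : M) => r *: m) tpure.
Proof.
split.
- move=> m1 m2 n; rewrite -lclsD; apply/lclsP.
  exists [:: n] => D sD DY P b [b1 b2 b3 b4]; rewrite !(big_cons, big_nil) /= addr0.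
  by rewrite b1 ?addr0 //; apply: DY; rewrite inE.
- move=> m n1 n2; rewrite -lclsD; apply/lclsP.
  exists [:: n1; n2] => D sD DY P b [b1 b2 b3 b4]; rewrite !(big_cons, big_nil) /= addr0.
  by rewrite b2 ?addr0 //; apply: DY; rewrite !inE eqxx ?orbT.
- move=> r m n; rewrite -lclsZ; apply/lclsP.
  exists [:: n] => D sD DY P b [b1 b2 b3 b4]; rewrite !(big_cons, big_nil) /= !addr0.
  by rewrite b3 ?b4 //; apply: DY; rewrite inE.
- by move=> r m n; rewrite -lclsZ; apply/lclsP; apply: tensor_eq_eq.
Qed.

Lemma sum_tpure (s : seq (M * N)) :
  \sum_(x <- s) tpure x.1 x.2 = @lcls _ tensor_lmod_setoid s.
Proof.
elim: s => [|[m n] s IH]; first by rewrite big_nil.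
by rewrite big_cons IH -lclsD.
Qed.

(** Testing [tensor_zero] on the single bilinear map [tpure] extracts one finite set [Y] valid for
    all codomains at once. *)
Lemma tensor_zero_eq_nil (s : seq (M * N)) :
  tensor_zero (fun r (m : M) => r *: m) s -> tensor_eq s [::].
Proof. by move=> /(_ _ _ tpure_bilinear); rewrite sum_tpure => /lcls_eq0. Qed.

End FormalTensor.

Definition von_neumann_regular (R : comPzRingType) : Prop :=
  forall a : R, exists x, a = a * a * x.

(** A finitely generated ideal of a von Neumann regular ring is generated by an idempotent; what is
    kept of this is an element of [I] that acts as the identity on the generators. In the induction,
    1 - x a kills the new generator a and 1 - e kills the old ones. *)
Lemma vnr_local_unit (R : comPzRingType) (I : R -> Prop) (s : seq R) :
  von_neumann_regular R -> ideal I -> (forall r, r \in s -> I r) ->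
  exists e, I e /\ forall r, r \in s -> e * r = r.
Proof.
move=> vnr [I0 IB IM]; elim: s => [|a s IH] Is; first by exists 0.
have [r rs|e [Ie es]] := IH; first by apply: Is; rewrite inE rs orbT.
have [x ax] := vnr a; have Ia : I a by apply: Is; rewrite inE eqxx.
(* [1 - e' = (1 - e) (1 - x a)] *)
exists (e - (e - 1) * x * a); split; first by apply: IB => //; apply: IM.
move=> r; rewrite inE => /predU1P[->|/es er].
  by transitivity (e * a - (e - 1) * (a * a * x)); [ring | rewrite -ax; ring].
by transitivity (e * r - (e * r - r) * x * a); [ring | rewrite er; ring].
Qed.

(** * Extending a bilinear map to one more generator *)

Section Adjoin.
Variables (R : comPzRingType) (M N P : lmodType R) (D : N -> Prop).
Variables (b : M -> N -> P) (y : N).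
Hypotheses (vnr : von_neumann_regular R) (subD : submodule D).
Hypothesis bil : bilinear_on D b.

Definition adjoin (n : N) : Prop := exists n0 r, D n0 /\ n = n0 + r *: y.

Lemma adjoin_submodule : submodule adjoin.
Proof.
split.
- by exists 0, 0; split; [apply: submod0 | rewrite scale0r addr0].
- move=> _ _ [n [r [Dn ->]]] [n' [r' [Dn' ->]]]; exists (n - n'), (r - r').
  by split; [apply: submodB | rewrite scalerBl opprD addrACA].
- move=> a _ [n [r [Dn ->]]]; exists (a *: n), (a * r).
  by split; [apply: submodZ | rewrite scalerDr scalerA].
Qed.

Lemma sub_adjoin n : D n -> adjoin n.
Proof. by exists n, 0; rewrite scale0r addr0. Qed.

Lemma mem_adjoin : adjoin y.
Proof. by exists 0, 1; rewrite scale1r add0r; split=> //; apply: submod0. Qed.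

Lemma bil0l n : D n -> b 0 n = 0.
Proof. by case: bil => _ _ b3 _ Dn; rewrite -(scale0r (0 : M)) b3 // scale0r. Qed.

(* The kernel of [P (+) M -> P (+)_(M (x) D) (M (x) (D + R y))], where [(0, m)]
   stands for [m (x) y]. *)
Definition adjoin_rel (u : P * M) : Prop :=
  exists t : seq (R * M), [/\ forall x, x \in t -> D (x.1 *: y),
    u.1 = \sum_(x <- t) b x.2 (x.1 *: y) & u.2 = - \sum_(x <- t) x.1 *: x.2].

Lemma adjoin_rel_scale a u : adjoin_rel u -> adjoin_rel (a *: u).
Proof.
case: bil => b1 b2 b3 b4 [t [tD t1 t2]]; exists [seq (x.1, a *: x.2) | x <- t]; split.
- by move=> _ /mapP[x xt ->]; exact: (tD x xt).
- rewrite big_map /= t1 scaler_sumr; apply: eq_big_seq => x xt /=.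
  by rewrite b3 //; apply: tD.
- rewrite big_map /= t2 scalerN scaler_sumr; congr (- _); apply: eq_bigr => x _.
  by rewrite !scalerA mulrC.
Qed.

Lemma adjoin_rel_submodule : submodule adjoin_rel.
Proof.
split; [by exists [::]; rewrite !big_nil oppr0 | | exact: adjoin_rel_scale].
move=> u v [t [tD t1 t2]] /(adjoin_rel_scale (-1)) [t' [tD' t1' t2']].
rewrite /= in t1' t2'; rewrite -scaleN1r; exists (t ++ t'); rewrite !big_cat /=; split.
- by move=> x; rewrite mem_cat => /orP[/tD | /tD'].
- by rewrite t1 t1'.
- by rewrite t2 t2' opprD.
Qed.

Definition adjoin_cod : lmodType R := quot adjoin_rel_submodule.

Definition adjoin_inj (p : P) : adjoin_cod := qcls adjoin_rel_submodule (p, 0).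

Lemma adjoin_inj_linear : linear adjoin_inj.
Proof.
move=> a p q; rewrite /adjoin_inj -linearP; congr qcls.
by congr pair; rewrite /= scaler0 addr0.
Qed.
HB.instance Definition _ :=
  GRing.isLinear.Build R P adjoin_cod _ adjoin_inj adjoin_inj_linear.

(** Regularity enters here. If the sum of the r_i m_i is 0 with all r_i y in [D], a local unit e of
    the ideal of r with r y in [D] gives b(m_i, r_i y) = b(r_i m_i, e y), and these add up to b(0, e
    y) = 0. *)
Lemma adjoin_inj_eq0 p : adjoin_inj p = 0 -> p = 0.
Proof.
case: bil => b1 b2 b3 b4 /qcls_eq0[t [tD /= -> /esym/eqP]]; rewrite oppr_eq0 => /eqP t0.
have idD : ideal (fun r => D (r *: y)).
  split=> [|r s Dr Ds|r s Ds].
  - by rewrite scale0r; apply: submod0.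
  - by rewrite scalerBl; apply: submodB.
  - by rewrite -scalerA; apply: submodZ.
have [r|e [De et]] := vnr_local_unit (s := unzip1 t) vnr idD.
  by case/mapP=> x xt ->; apply: tD.
transitivity (\sum_(x <- t) b (x.1 *: x.2) (e *: y)).
  apply: eq_big_seq => x xt; rewrite b3 // -b4 // scalerA mulrC et //.
  exact: map_f.
rewrite -(big_morph (b^~ (e *: y)) (id1 := 0) (op1 := +%R)
  (id2 := 0) (op2 := +%R)).
- by rewrite t0 bil0l.
- by move=> m m'; rewrite b1.
- exact: bil0l.
Qed.

(** The decomposition n = n0 + r y is picked by choice; [adjoin_bilE] shows that the class does not
    depend on it. Outside [adjoin] the value 0 is a dummy. *)
Definition adjoin_bil (m : M) (n : N) : adjoin_cod :=
  if pselect (exists x : N * R, D x.1 /\ n = x.1 + x.2 *: y) is left ex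
  then let x := projT1 (cid ex) in qcls adjoin_rel_submodule (b m x.1, x.2 *: m)
  else 0.

Lemma adjoin_bilE m n r : D n ->
  adjoin_bil m (n + r *: y) = qcls adjoin_rel_submodule (b m n, r *: m).
Proof.
case: (bil) => b1 b2 b3 b4 Dn; rewrite /adjoin_bil.
case: pselect => [ex|[]]; last by exists (n, r).
case: (cid ex) => -[n' r'] /= [Dn' eqn]; apply/qclsP.
have Drr : (r - r') *: y = n' - n.
  by apply/eqP; rewrite scalerBl subr_eq addrAC eq_sym subr_eq -eqn addrC.
(* Two decompositions of one element satisfy (r - r') y = n' - n, which lies in [D], so a single
   term witnesses the relation. *)
exists [:: (r - r', m)]; rewrite !big_cons !big_nil /= !addr0; split.
- by move=> x; rewrite inE => /eqP -> /=; rewrite Drr; apply: submodB.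
- rewrite Drr b2 //; last by apply: submodN.
  by rewrite -[- n]scaleN1r b4 // scaleN1r.
- by rewrite scalerBl opprB.
Qed.

Lemma adjoin_bil_on m n : D n -> adjoin_bil m n = adjoin_inj (b m n).
Proof.
by move=> Dn; rewrite -[n in LHS]addr0 -(scale0r y) adjoin_bilE // scale0r.
Qed.

Lemma adjoin_bilinear : bilinear_on adjoin adjoin_bil.
Proof.
case: (bil) => b1 b2 b3 b4; split.
- move=> m1 m2 _ [n [r [Dn ->]]]; rewrite !adjoin_bilE // -[RHS]linearD; congr qcls.
  by rewrite b1 // scalerDr.
- move=> m _ _ [n [r [Dn ->]]] [n' [r' [Dn' ->]]].
  rewrite addrACA -scalerDl !adjoin_bilE //; last exact: submodD.
  by rewrite -[RHS]linearD; congr qcls; rewrite b2 // scalerDl.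
- move=> a m _ [n [r [Dn ->]]]; rewrite !adjoin_bilE // -[RHS]linearZZ; congr qcls.
  by rewrite b3 // scalerA mulrC -scalerA.
- move=> a m _ [n [r [Dn ->]]]; rewrite scalerDr scalerA !adjoin_bilE //.
    by rewrite -[RHS]linearZZ; congr qcls; rewrite b4 // -scalerA.
  exact: submodZ.
Qed.

End Adjoin.

(** Purity of [D] in [N]: a formal sum over [D] that vanishes in [M (x) N] vanishes in [M (x) D].
    The elements of [Y] are adjoined to [D] one at a time, and each step embeds the codomain in a
    larger one, so vanishing can be pulled back. *)
Lemma vnr_sum_bilinear0 (R : comPzRingType) (M N P : lmodType R) (D : N -> Prop)
    (b : M -> N -> P) (s : seq (M * N)) :
  von_neumann_regular R -> submodule D -> bilinear_on D b ->
  (forall x, x \in s -> D x.2) ->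
  tensor_eq s [::] -> \sum_(x <- s) b x.1 x.2 = 0.
Proof.
move=> vnr subD bil Ds [Y eqY].
(* Restricting to [D'] above [D] makes the induction run: once y is adjoined to [D], every such [D']
   contains it, and y can leave the list. *)
have {}eqY : forall D' : N -> Prop, submodule D' -> (forall n, D n -> D' n) ->
    (forall n, n \in Y -> D' n) -> forall (P' : lmodType R) (b' : M -> N -> P'),
    bilinear_on D' b' -> \sum_(x <- s) b' x.1 x.2 = 0.
  by move=> D' subD' _ DY P' b' bil'; rewrite (eqY D') // big_nil.
elim: Y D P b subD bil Ds eqY => [|y Y IH] D P b subD bil Ds eqY.
  exact: (eqY D).
apply: (adjoin_inj_eq0 (y := y) (bil := bil) vnr subD).
rewrite linear_sum.
apply: etrans (IH _ _ _ (adjoin_submodule y subD) (adjoin_bilinear y subD bil) _ _).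
- by apply: eq_big_seq => x /Ds Dx; rewrite adjoin_bil_on.
- by move=> x /Ds; apply: sub_adjoin.
- move=> D' subD' DD' YD'; apply: eqY => //.
    by move=> n Dn; apply: DD'; apply: sub_adjoin.
  move=> n; rewrite inE => /predU1P[->|]; last exact: YD'.
  by apply: DD'; apply: mem_adjoin.
Qed.

(** The injection [f] identifies [N] with its image [D] in [N']. Composing [b] with the inverse [g]
    of [f] on [D] gives a map bilinear on [D], to which purity applies. *)
Lemma vnr_absolutely_flat (R : comPzRingType) :
  von_neumann_regular R -> absolutely_flat R.
Proof.
move=> vnr M N N' f inj_f s /tensor_zero_eq_nil fs0 P b [b1 b2 b3 b4].
pose D n' := exists n, n' = f n.
have subD : submodule D.
  split; first by exists 0; rewrite linear0.
    by move=> _ _ [x ->] [x' ->]; exists (x - x'); rewrite linearB.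
  by move=> a _ [x ->]; exists (a *: x); rewrite linearZ.
pose g n' := if pselect (D n') is left ex then projT1 (cid ex) else 0.
have fK n : g (f n) = n.
  rewrite /g; case: pselect => [ex|[]]; last by exists n.
  by case: (cid ex) => x /= /inj_f.
have bil : bilinear_on D (fun m n' => b m (g n')).
  split.
  - by move=> m1 m2 n' _; rewrite b1.
  - by move=> m _ _ [x ->] [x' ->]; rewrite -linearD !fK b2.
  - by move=> r m n' _; rewrite b3.
  - by move=> r m _ [x ->]; rewrite -linearZ !fK b4.
have fsD x : x \in [seq (x.1, f x.2) | x <- s] -> D x.2.
  by case/mapP=> y _ ->; exists y.2.
rewrite -[RHS](vnr_sum_bilinear0 vnr subD bil fsD fs0) big_map.
by apply: eq_bigr => x _ /=; rewrite fK.
Qed.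

Lemma ideal_submodule (R : comPzRingType) (I : R -> Prop) :
  ideal I -> submodule (V := R^o) I.
Proof. by []. Qed.

(** Multiplication by f embeds R/ann(f) in R. Tensored with R/(f), it sends 1 (x) 1 to 1 (x) f = f
    (x) 1 = 0. By flatness 1 (x) 1 = 0 in R/(f) (x) R/ann(f) = R/((f) + ann(f)), hence 1 lies in (f)
    + ann(f) and f in f^2 R. *)
Lemma absolutely_flat_vnr (R : comPzRingType) :
  absolutely_flat R -> von_neumann_regular R.
Proof.
move=> af f.
pose I x := exists a, x = a * f.
pose J x := f * x = 0.
(* This is the ideal [I + J], in a form where [K 1] is the desired conclusion. *)
pose K x := exists a, f * x = f * f * a.
have idI : submodule (V := R^o) I.
  apply: ideal_submodule; split; first by exists 0; rewrite mul0r.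
    by move=> _ _ [a ->] [b ->]; exists (a - b); rewrite mulrBl.
  by move=> r _ [a ->]; exists (r * a); rewrite mulrA.
have idJ : submodule (V := R^o) J.
  apply: ideal_submodule; split; rewrite /J; first exact: mulr0.
    by move=> x y fx fy; rewrite mulrBr fx fy subr0.
  by move=> r x fx; rewrite mulrCA fx mulr0.
have idK : submodule (V := R^o) K.
  apply: ideal_submodule; split; first by exists 0; rewrite !mulr0.
    by move=> x y [a fx] [b fy]; exists (a - b); rewrite !mulrBr fx fy.
  by move=> r x [a fx]; exists (r * a); rewrite mulrCA fx mulrCA.
pose g (q : quot idJ) : R^o := f * qrep q.
have gE x : g (qcls idJ x) = f * x.
  have : f * (qrep (qcls idJ x) - x) = 0 by exact: (qrep_cls idJ x).
  by rewrite mulrBr => /eqP; rewrite subr_eq0 => /eqP.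
have g_linear : linear g.
  move=> a; elim/qclsW=> x; elim/qclsW=> y.
  by rewrite -linearP !gE mulrDr mulrCA.
pose gL : {linear quot idJ -> R^o} := HB.pack g (GRing.isLinear.Build _ _ _ _ g g_linear).
have g_inj : injective gL.
  elim/qclsW=> x; elim/qclsW=> y; rewrite /= !gE => fxy.
  by apply/qclsP; rewrite /J mulrBr fxy subrr.
pose mul (x : quot idI) (y : quot idJ) : quot idK := qcls idK (qrep x * qrep y : R).
have mulE x y : mul (qcls idI x) (qcls idJ y) = qcls idK (x * y : R).
  have [a] : I (qrep (qcls idI x) - x) by exact: (qrep_cls idI x).
  have : J (qrep (qcls idJ y) - y) by exact: (qrep_cls idJ y).
  rewrite /mul /J; move: (qrep _) (qrep _) => x' y' fy xa.
  apply/qclsP; exists (a * y); rewrite /=.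
  transitivity (f * (x' - x) * y + x' * (f * (y' - y))); first by ring.
  by rewrite fy xa; ring.
have mul_bil : bilinear_act (fun r (x : quot idI) => r *: x) mul.
  split.
  - elim/qclsW=> x; elim/qclsW=> x'; elim/qclsW=> y.
    by rewrite -linearD !mulE -linearD mulrDl.
  - elim/qclsW=> x; elim/qclsW=> y; elim/qclsW=> y'.
    by rewrite -linearD !mulE -linearD mulrDr.
  - move=> r; elim/qclsW=> x; elim/qclsW=> y.
    by rewrite -[_ *: qcls idI _]linearZ !mulE -[RHS]linearZZ; congr qcls; rewrite -mulrA.
  - move=> r; elim/qclsW=> x; elim/qclsW=> y.
    by rewrite -[_ *: qcls idJ _]linearZ !mulE -[RHS]linearZZ; congr qcls; rewrite mulrCA.
have t0 : tensor_zero (fun r (x : quot idI) => r *: x) [:: (qcls idI 1, qcls idJ 1)].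
  apply: (af (quot idI) _ _ gL g_inj).
  move=> P b [b1 b2 b3 b4] /=; rewrite big_cons big_nil addr0 /= gE.
  rewrite (_ : f * 1 = f *: (1 : R^o)) // b4 -b3 -linearZ /=.
  rewrite (_ : qcls idI (f *: (1 : R^o)) = 0) ?b3; last first.
    by apply/qcls_eq0; exists 1; rewrite mul1r; apply: mulr1.
  by rewrite -(scale0r (0 : quot idI)) b3 scale0r.
have := t0 _ _ mul_bil.
rewrite big_cons big_nil addr0 /= mulE => /qcls_eq0[a].
by rewrite !mulr1 => ?; exists a.
Qed.

(** * Flat epimorphisms *)

(** The synonym mentions [phi] so that the R-module structure induced by [phi] can be attached to
    it. *)
Definition restrict_scalars (R S : comPzRingType) (phi : {rmorphism R -> S}) : Type := S.

Section RestrictScalars.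
Variables (R S : comPzRingType) (phi : {rmorphism R -> S}).

HB.instance Definition _ := GRing.Zmodule.copy (restrict_scalars phi) S.

Let scale (r : R) (s : restrict_scalars phi) : restrict_scalars phi := phi r * (s : S).

Let scaleA a b v : scale a (scale b v) = scale (a * b) v.
Proof. by rewrite /scale rmorphM mulrA. Qed.
Let scale1 : left_id 1 scale.
Proof. by move=> v; rewrite /scale rmorph1 mul1r. Qed.
Let scaleDr : right_distributive scale +%R.
Proof. by move=> a u v; rewrite /scale -mulrDr. Qed.
Let scaleDl v : {morph scale^~ v: a b / a + b}.
Proof. by move=> a b; rewrite /scale rmorphD mulrDl. Qed.

HB.instance Definition _ := GRing.Zmodule_isLmodule.Build R (restrict_scalars phi)
  scaleA scale1 scaleDr scaleDl.

End RestrictScalars.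

(** * The ring S (x)_R S *)

Section TensorSquare.
Variables (R S : comPzRingType) (phi : {rmorphism R -> S}).

Definition balanced (P : zmodType) (b : S -> S -> P) : Prop :=
  [/\ forall x x' y, b (x + x') y = b x y + b x' y,
      forall x y y', b x (y + y') = b x y + b x y'
    & forall r x y, b (phi r * x) y = b x (phi r * y)].

(** Equality in S (x)_R S, read off from its universal property among abelian groups. *)
Definition square_eq (s t : seq (S * S)) : Prop :=
  forall (P : zmodType) (b : S -> S -> P), balanced b ->
    \sum_(x <- s) b x.1 x.2 = \sum_(x <- t) b x.1 x.2.

Lemma square_eq_eq s t : s = t -> square_eq s t.
Proof. by move->. Qed.

Program Definition square_zmod_setoid : zmod_setoid :=
  @ZmodSetoid (seq (S * S)) square_eq _ _ _ nil
    (fun s => [seq (- x.1, x.2) | x <- s]) cat _ _ _ _ _ _.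
Next Obligation. by move=> s P b. Qed.
Next Obligation. by move=> s t st P b bb; rewrite st. Qed.
Next Obligation. by move=> s t u st tu P b bb; rewrite st // tu. Qed.
Next Obligation.
move=> s t st P b [b1 b2 b3]; rewrite !big_map /=; apply: (st P (fun m n => b (- m) n)).
by split=> *; rewrite ?opprD -?mulrN.
Qed.
Next Obligation.
by move=> s s' t t' ss' tt' P b bb; rewrite !big_cat /= ss' // tt'.
Qed.
Next Obligation. by move=> s t u; apply: square_eq_eq; rewrite catA. Qed.
Next Obligation. by move=> s t P b _; rewrite !big_cat /= addrC. Qed.
Next Obligation. by move=> s; apply: square_eq_eq. Qed.
Next Obligation.
move=> s P b [b1 b2 b3]; rewrite big_cat big_map big_nil /= -big_split.
apply: big1 => -[u v] _ /=; rewrite -b1 addNr.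
by apply: (addrI (b 0 v)); rewrite -b1 !addr0.
Qed.

Definition square_mul (s t : seq (S * S)) : seq (S * S) :=
  [seq (x.1 * y.1, x.2 * y.2) | x <- s, y <- t].

Lemma sum_square_mul (P : zmodType) (b : S -> S -> P) s t :
  \sum_(z <- square_mul s t) b z.1 z.2 =
  \sum_(x <- s) \sum_(y <- t) b (x.1 * y.1) (x.2 * y.2).
Proof. by rewrite big_allpairs_dep. Qed.

Lemma square_mulC s t : square_eq (square_mul s t) (square_mul t s).
Proof.
move=> P b _; rewrite !sum_square_mul exchange_big.
by do 2!apply: eq_bigr => ? _; congr b; rewrite mulrC.
Qed.

(** Multiplying by the fixed sum [t] inside both arguments of [b] gives another balanced map, on
    which [s] and [s'] agree. The other factor follows by commutativity. *)
Lemma square_mul_eql s s' t :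
  square_eq s s' -> square_eq (square_mul s t) (square_mul s' t).
Proof.
move=> ss' P b [b1 b2 b3]; rewrite !sum_square_mul.
apply: (ss' P (fun u v => \sum_(y <- t) b (u * y.1) (v * y.2))); split.
- by move=> x x' y; rewrite -big_split; apply: eq_bigr => z _ /=; rewrite mulrDl b1.
- by move=> x y y'; rewrite -big_split; apply: eq_bigr => z _ /=; rewrite mulrDl b2.
- by move=> r x y; apply: eq_bigr => z _ /=; rewrite -!mulrA b3.
Qed.

Program Definition square_ring_setoid : ring_setoid :=
  @RingSetoid square_zmod_setoid [:: (1, 1)] square_mul _ _ _ _ _.
Next Obligation.
move=> s s' t t' ss' tt' P b bb.
rewrite (square_mul_eql t ss' bb) (square_mulC _ _ bb).
by rewrite (square_mul_eql s' tt' bb) (square_mulC _ _ bb).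
Qed.
Next Obligation.
move=> s t u P b _; rewrite !sum_square_mul.
rewrite [RHS]big_allpairs_dep; apply: eq_bigr => x _.
rewrite [LHS]big_allpairs_dep; apply: eq_bigr => y _.
by apply: eq_bigr => z _ /=; rewrite !mulrA.
Qed.
Next Obligation. exact: square_mulC. Qed.
Next Obligation.
move=> s P b _; rewrite sum_square_mul big_seq1 /=.
by apply: eq_bigr => u _; rewrite !mul1r.
Qed.
Next Obligation.
by move=> s t u; apply: square_eq_eq; rewrite /square_mul allpairs_cat.
Qed.

Definition square : comPzRingType := rquot square_ring_setoid.

Definition square_inl (x : S) : square := @rcls square_ring_setoid [:: (x, 1)].
Definition square_inr (x : S) : square := @rcls square_ring_setoid [:: (1, x)].

Lemma square_inl_zmod : zmod_morphism square_inl.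
Proof.
move=> x y; apply: (addIr (square_inl y)); rewrite subrK.
rewrite -(@rclsD square_ring_setoid); apply/rclsP => P b [b1 _ _].
by rewrite !big_cons !big_nil /= !addr0 -b1 subrK.
Qed.

Lemma square_inl_monoid : monoid_morphism square_inl.
Proof.
split=> // x y; rewrite -(@rclsM square_ring_setoid); congr rcls.
by rewrite /= /square_mul /= mulr1.
Qed.
HB.instance Definition _ :=
  GRing.isZmodMorphism.Build S square square_inl square_inl_zmod.
HB.instance Definition _ :=
  GRing.isMonoidMorphism.Build S square square_inl square_inl_monoid.

Lemma square_inr_zmod : zmod_morphism square_inr.
Proof.
move=> x y; apply: (addIr (square_inr y)); rewrite subrK.
rewrite -(@rclsD square_ring_setoid); apply/rclsP => P b [_ b2 _].
by rewrite !big_cons !big_nil /= !addr0 -b2 subrK.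
Qed.

Lemma square_inr_monoid : monoid_morphism square_inr.
Proof.
split=> // x y; rewrite -(@rclsM square_ring_setoid); congr rcls.
by rewrite /= /square_mul /= mulr1.
Qed.
HB.instance Definition _ :=
  GRing.isZmodMorphism.Build S square square_inr square_inr_zmod.
HB.instance Definition _ :=
  GRing.isMonoidMorphism.Build S square square_inr square_inr_monoid.

(** The two inclusions of S in S (x)_R S agree on phi(R), hence everywhere; thus s (x) 1 = 1 (x) s,
    and a balanced map respects this equality. *)
Lemma epi_balanced (P : zmodType) (b : S -> S -> P) (s : S) :
  ring_epi phi -> balanced b -> b s 1 = b 1 s.
Proof.
move=> /(_ square square_inl square_inr) epi bb.
have /rclsP/(_ P b bb) : square_inl s = square_inr s.
  apply: epi => r; apply/rclsP => Q c [_ _ c3].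
  by rewrite !big_cons !big_nil /= -{1}[phi r]mulr1 c3 mulr1.
by rewrite !big_seq1.
Qed.

End TensorSquare.

(** * Denominators of an element under a flat epimorphism *)

Section Lazard.
Variables (R S : comPzRingType) (phi : {rmorphism R -> S}) (s : S).
Hypotheses (flat_phi : flat_ringmorph phi) (epi_phi : ring_epi phi).

Definition denominator (r : R) : Prop := exists r', phi r * s = phi r'.

Lemma denominator_ideal : ideal denominator.
Proof.
split; first by exists 0; rewrite rmorph0 mul0r.
  by move=> x y [x' xE] [y' yE]; exists (x' - y'); rewrite !rmorphB mulrBl xE yE.
by move=> r x [x' xE]; exists (r * x'); rewrite !rmorphM -mulrA xE.
Qed.

Let SR : lmodType R := restrict_scalars phi.

Let image (x : SR) : Prop := exists r, x = phi r.

Let image_submodule : submodule image.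
Proof.
split; first by exists 0; rewrite rmorph0.
  by move=> _ _ [x ->] [y ->]; exists (x - y); rewrite rmorphB.
by move=> a _ [x ->]; exists (a * x); rewrite rmorphM.
Qed.

(** The ideal of S generated by the image of [denominator], seen as an R-submodule because bilinear
    maps take values in R-modules. *)
Let extended (x : SR) : Prop := exists t : seq (R * S),
  (forall y, y \in t -> denominator y.1) /\ x = \sum_(y <- t) phi y.1 * y.2.

Let extended_submodule : submodule extended.
Proof.
split; first by exists [::]; rewrite big_nil.
- move=> _ _ [t [tI ->]] [t' [tI' ->]]; exists (t ++ [seq (y.1, - y.2) | y <- t']).
  split; last first.
    rewrite big_cat big_map /= -sumrN; congr (_ + _).
    by apply: eq_bigr => y _; rewrite mulrN.
  by move=> y; rewrite mem_cat => /orP[/tI // | /mapP[z /tI' zI ->]].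
- move=> a _ [t [tI ->]]; exists [seq (y.1, phi a * y.2) | y <- t]; split.
    by move=> y /mapP[z /tI zI ->].
  rewrite big_map /= [LHS]mulr_sumr; apply: eq_bigr => y _.
  by rewrite mulrCA.
Qed.

(* Multiplication by [s] embeds [R / denominator] into [S / phi(R)]; after
   tensoring with [S], [1 (x) 1] goes to [1 (x) s = s (x) 1 = 0], hence is zero. *)
Lemma denominator_generates : exists t : seq (R * S),
  (forall y, y \in t -> denominator y.1) /\ 1 = \sum_(y <- t) phi y.1 * y.2.
Proof.
have idI : submodule (V := R^o) denominator := ideal_submodule denominator_ideal.
pose f (q : quot idI) : quot image_submodule := qcls image_submodule (phi (qrep q) * s).
have fE x : f (qcls idI x) = qcls image_submodule (phi x * s).
  apply/qclsP; have [r rE] := qrep_cls idI x; exists r.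
  by rewrite -rE rmorphB mulrBl.
have f_linear : linear f.
  move=> a; elim/qclsW=> x; elim/qclsW=> y.
  rewrite -linearP !fE -linearP; congr qcls.
  by rewrite rmorphD rmorphM mulrDl -mulrA.
pose fL : {linear quot idI -> quot image_submodule} :=
  HB.pack f (GRing.isLinear.Build _ _ _ _ f f_linear).
have f_inj : injective fL.
  elim/qclsW=> x; elim/qclsW=> y; rewrite /= !fE => /qclsP[r rE].
  by apply/qclsP; exists r; rewrite -rE rmorphB mulrBl.
(* With I = [denominator], the map S (x) R/I -> S/IS turns 1 (x) 1 = 0 into membership of 1 in
   IS. *)
pose mul (x : S) (q : quot idI) : quot extended_submodule :=
  qcls extended_submodule (phi (qrep q) * x).
have mulE x r : mul x (qcls idI r) = qcls extended_submodule (phi r * x).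
  apply/qclsP; exists [:: (qrep (qcls idI r) - r : R, x)]; split.
    by move=> y; rewrite inE => /eqP ->; apply: (qrep_cls idI r).
  by rewrite big_seq1 /= rmorphB mulrBl.
have mul_bil : bilinear_act (fun r (x : S) => phi r * x) mul.
  split.
  - move=> x x'; elim/qclsW=> r; rewrite !mulE -linearD; congr qcls.
    by rewrite mulrDr.
  - move=> x; elim/qclsW=> r; elim/qclsW=> r'.
    by rewrite -linearD !mulE -linearD; congr qcls; rewrite rmorphD mulrDl.
  - move=> a x; elim/qclsW=> r; rewrite !mulE -[RHS]linearZZ; congr qcls.
    by rewrite mulrCA.
  - move=> a x; elim/qclsW=> r; rewrite -[_ *: qcls idI _]linearZ !mulE -[RHS]linearZZ.
    by congr qcls; rewrite rmorphM -mulrA.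
have t0 : tensor_zero (fun r (x : S) => phi r * x) [:: (1, qcls idI 1)].
  apply: (flat_phi f_inj).
  move=> P b [b1 b2 b3 b4] /=; rewrite big_seq1 /= fE rmorph1 mul1r.
  pose c (x y : S) : P := b x (qcls image_submodule y).
  rewrite -[LHS]/(c 1 s) -(epi_balanced (phi := phi) _ epi_phi); last first.
    split; rewrite /c.
    + by move=> *; apply: b1.
    + by move=> x y y'; rewrite -b2 -linearD.
    + by move=> r x y; rewrite b3 -b4 -linearZ.
  rewrite /c (_ : qcls _ _ = 0); last by apply/qcls_eq0; exists 1; rewrite rmorph1.
  by rewrite -(scale0r (0 : quot image_submodule)) b4 scale0r.
have := t0 _ _ mul_bil.
rewrite big_seq1 mulE rmorph1 mul1r => /qcls_eq0[t [tI tE]].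
by exists t.
Qed.

End Lazard.

(** * Localization *)

Section Localization.
Variables (R : comPzRingType) (W : R -> Prop).
Hypotheses (W1 : W 1) (WM : forall a b, W a -> W b -> W (a * b)).

Definition denom := {s : R | W s}.
Definition denom1 : denom := exist _ 1 W1.
Definition denomM (s t : denom) : denom :=
  exist _ (sval s * sval t) (WM (svalP s) (svalP t)).

Section Module.
Variable M : lmodType R.

Definition frac_eq (x y : M * denom) : Prop :=
  exists t, W t /\ (t * sval y.2) *: x.1 = (t * sval x.2) *: y.1.

Lemma frac_eqW x y : sval y.2 *: x.1 = sval x.2 *: y.1 -> frac_eq x y.
Proof. by exists 1; rewrite !mul1r. Qed.

Program Definition frac_zmod_setoid : zmod_setoid :=
  @ZmodSetoid (M * denom) frac_eq _ _ _ (0, denom1) (fun x => (- x.1, x.2))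
    (fun x y => (sval y.2 *: x.1 + sval x.2 *: y.1, denomM x.2 y.2)) _ _ _ _ _ _.
Next Obligation. by move=> x; apply: frac_eqW. Qed.
Next Obligation. by move=> x y [t [Wt tE]]; exists t. Qed.
Next Obligation.
move=> [m [a Wa]] [n [b Wb]] [k [c Wc]] [t [/= Wt tE]] [r [/= Wr rE]].
exists (t * r * b); split; first by do 2?[apply: WM].
rewrite /=.
transitivity ((r * c) *: ((t * b) *: m)); first by rewrite scalerA; congr (_ *: _); ring.
rewrite tE; transitivity ((t * a) *: ((r * c) *: n)).
  by rewrite !scalerA; congr (_ *: _); ring.
by rewrite rE scalerA; congr (_ *: _); ring.
Qed.
Next Obligation.
by move=> x y [t [Wt tE]]; exists t; rewrite /= !scalerN tE.
Qed.
Next Obligation.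
move=> [m [a Wa]] [m' [a' Wa']] [n [b Wb]] [n' [b' Wb']] [t [/= Wt tE]] [r [/= Wr rE]].
exists (t * r); split; first exact: WM.
rewrite /= !scalerDr !scalerA; congr (_ + _).
  transitivity ((r * b * b') *: ((t * a') *: m)).
    by rewrite scalerA; congr (_ *: _); ring.
  by rewrite tE scalerA; congr (_ *: _); ring.
transitivity ((t * a * a') *: ((r * b') *: n)).
  by rewrite scalerA; congr (_ *: _); ring.
by rewrite rE scalerA; congr (_ *: _); ring.
Qed.
Next Obligation.
move=> [m [a Wa]] [n [b Wb]] [k [c Wc]]; apply: frac_eqW => /=.
rewrite !scalerDr !scalerA addrA.
by congr (_ *: _ + _ *: _ + _ *: _); ring.
Qed.
Next Obligation.
move=> [m [a Wa]] [n [b Wb]]; apply: frac_eqW => /=.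
by rewrite addrC mulrC.
Qed.
Next Obligation.
by move=> [m [a Wa]]; apply: frac_eqW; rewrite /= scaler0 add0r scale1r mul1r.
Qed.
Next Obligation.
by move=> [m [a Wa]]; apply: frac_eqW; rewrite /= scalerN addNr !scaler0.
Qed.

Program Definition frac_lmod_setoid : lmod_setoid R :=
  @LmodSetoid R frac_zmod_setoid (fun r (x : M * denom) => (r *: x.1, x.2)) _ _ _ _ _.
Next Obligation.
move=> r x y [t [Wt tE]]; exists t; split=> //=.
have rA c m : c *: (r *: m) = r *: (c *: m) by rewrite !scalerA mulrC.
by rewrite !rA tE.
Qed.
Next Obligation. by move=> a b x; apply: frac_eqW; rewrite /= !scalerA !mulrA. Qed.
Next Obligation. by move=> x; apply: frac_eqW; rewrite /= scale1r. Qed.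
Next Obligation.
move=> r [m [a Wa]] [n [b Wb]]; apply: frac_eqW => /=.
rewrite !scalerDr !scalerA.
by congr (_ *: _ + _ *: _); ring.
Qed.
Next Obligation.
move=> r r' [m [a Wa]]; apply: frac_eqW => /=.
rewrite scalerDl !scalerDr !scalerA.
by congr (_ *: _ + _ *: _); ring.
Qed.

(** Localized modules serve as targets of the bilinear map that tests flatness in [loc_map_flat];
    the same fractions with M = R underlie [loc_ring]. *)
Definition loc_module : lmodType R := lquot frac_lmod_setoid.
Definition frac (m : M) (s : denom) : loc_module := @lcls _ frac_lmod_setoid (m, s).

Lemma fracP m s n t : frac m s = frac n t <-> frac_eq (m, s) (n, t).
Proof. exact: lclsP. Qed.

Lemma fracZ r m s : frac (r *: m) s = r *: frac m s.
Proof. exact: (@lclsZ _ frac_lmod_setoid r (m, s)). Qed.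

Lemma fracD m n s t : frac m s + frac n t = frac (sval t *: m + sval s *: n) (denomM s t).
Proof. by rewrite -[LHS]lclsD. Qed.

Lemma fracDl m n s : frac (m + n) s = frac m s + frac n s.
Proof.
rewrite fracD; apply/fracP/frac_eqW.
by rewrite /= -scalerDr scalerA.
Qed.

Lemma frac_eq0 m s : frac m s = 0 -> exists t, W t /\ t *: m = 0.
Proof.
by move=> /lcls_eq0[t [Wt /=]]; rewrite mulr1 scaler0 => tm; exists t.
Qed.

End Module.

Program Definition frac_ring_setoid : ring_setoid :=
  @RingSetoid (frac_zmod_setoid R^o) (1, denom1)
    (fun x y : R * denom => (x.1 * y.1, denomM x.2 y.2)) _ _ _ _ _.
Next Obligation.
move=> [m [a Wa]] [m' [a' Wa']] [n [b Wb]] [n' [b' Wb']] [t [Wt tE]] [r [Wr rE]].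
rewrite /= /GRing.scale /= in tE rE.
exists (t * r); split; first exact: WM.
rewrite /= /GRing.scale /=.
transitivity ((t * a' * m) * (r * b' * n)); first by ring.
by rewrite tE rE; ring.
Qed.
Next Obligation.
move=> [m [a Wa]] [n [b Wb]] [k [c Wc]]; apply: frac_eqW; rewrite /= /GRing.scale /=; ring.
Qed.
Next Obligation.
by move=> [m [a Wa]] [n [b Wb]]; apply: frac_eqW; rewrite /= /GRing.scale /=; ring.
Qed.
Next Obligation.
by move=> [m [a Wa]]; apply: frac_eqW; rewrite /= /GRing.scale /=; ring.
Qed.
Next Obligation.
move=> [m [a Wa]] [n [b Wb]] [k [c Wc]]; apply: frac_eqW.
by rewrite /= /GRing.scale /=; ring.
Qed.

Definition loc_ring : comPzRingType := rquot frac_ring_setoid.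
Definition rfrac (a : R) (s : denom) : loc_ring := @rcls frac_ring_setoid (a, s).

Lemma rfracP a s b t : rfrac a s = rfrac b t <->
  exists u, W u /\ u * (a * sval t) = u * (b * sval s).
Proof.
split=> [/rclsP[u [Wu uE]]|[u [Wu uE]]]; last apply/rclsP; exists u; split=> //.
  move: uE; rewrite /= /GRing.scale /= => uE.
  by transitivity (u * sval t * a); [ring | rewrite uE; ring].
rewrite /= /GRing.scale /=.
by transitivity (u * (a * sval t)); [ring | rewrite uE; ring].
Qed.

Lemma rfracW a s b t : a * sval t = b * sval s -> rfrac a s = rfrac b t.
Proof. by move=> abE; apply/rfracP; exists 1; rewrite !mul1r. Qed.

Lemma rfracM a b s t : rfrac a s * rfrac b t = rfrac (a * b) (denomM s t).
Proof. by rewrite -[LHS](@rclsM frac_ring_setoid). Qed.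

Lemma rfracD a b s t :
  rfrac a s + rfrac b t = rfrac (sval t * a + sval s * b) (denomM s t).
Proof. by rewrite -[LHS](@rclsD frac_ring_setoid). Qed.

Lemma rfrac_ind (P : loc_ring -> Prop) : (forall a s, P (rfrac a s)) -> forall q, P q.
Proof. by move=> Pf; elim/rquotW=> -[a s]; apply: Pf. Qed.

Definition loc_map (a : R) : loc_ring := rfrac a denom1.

Lemma loc_map_zmod : zmod_morphism loc_map.
Proof.
move=> a b; apply: (addIr (loc_map b)); rewrite subrK rfracD.
by apply: rfracW => /=; ring.
Qed.

Lemma loc_map_monoid : monoid_morphism loc_map.
Proof. by split=> // a b; rewrite rfracM; apply: rfracW => /=; ring. Qed.

HB.instance Definition _ := GRing.isZmodMorphism.Build R loc_ring loc_map loc_map_zmod.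
HB.instance Definition _ := GRing.isMonoidMorphism.Build R loc_ring loc_map loc_map_monoid.

Lemma loc_mapM_frac r a s : loc_map r * rfrac a s = rfrac (r * a) s.
Proof. by rewrite rfracM; apply: rfracW => /=; ring. Qed.

(** Inverses are unique: g(1/s) and h(1/s) both invert the common value of g and h at s/1. *)
Lemma loc_map_epi : ring_epi loc_map.
Proof.
move=> T g h gh; elim/rfrac_ind=> a s.
have inv_s : rfrac 1 s * loc_map (sval s) = 1.
  by rewrite rfracM; apply: rfracW => /=; ring.
have -> : rfrac a s = loc_map a * rfrac 1 s by rewrite loc_mapM_frac mulr1.
rewrite !rmorphM /= gh; congr (_ * _).
have gs : g (rfrac 1 s) * h (loc_map (sval s)) = 1 by rewrite -gh -rmorphM inv_s rmorph1.
have hs : h (rfrac 1 s) * h (loc_map (sval s)) = 1 by rewrite -rmorphM inv_s rmorph1.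
by rewrite -[LHS]mulr1 -hs mulrCA gs mulr1.
Qed.

(** Every element of the localization tensored with N is a pure tensor 1/d (x) n. The pair d, n is
    chosen before [f] and [b], so it serves both [s] and its image under an injection. *)
Lemma loc_common_denominator (N : lmodType R) (s : seq (loc_ring * N)) :
  exists d n, forall (N' P : lmodType R) (f : {linear N -> N'}) (b : loc_ring -> N' -> P),
    bilinear_act (fun r q => loc_map r * q) b ->
    \sum_(x <- s) b x.1 (f x.2) = b (rfrac 1 d) (f n).
Proof.
elim: s => [|[q n] s [d [k IH]]].
  exists denom1, 0 => N' P f b [b1 b2 b3 b4].
  by rewrite big_nil linear0 -(scale0r (0 : N')) b4 scale0r.
elim/rfrac_ind: q => a c.
exists (denomM c d), ((sval d * a) *: n + sval c *: k) => N' P f b bil.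
rewrite big_cons (IH _ _ _ _ bil) /=; case: bil => b1 b2 b3 b4.
rewrite linearD b2 !linearZ !b4 -!b3 !loc_mapM_frac.
by congr (b _ _ + b _ _); apply: rfracW => /=; ring.
Qed.

(** Reduce to 1/d (x) n. If its image vanishes, then f(n)/d = 0 in the localized module, so u f(n) =
    0 for some u in [W], and u n = 0 by injectivity. Then 1/d (x) n = 1/(u d) (x) u n = 0. *)
Lemma loc_map_flat : flat_ringmorph loc_map.
Proof.
move=> N N' f inj_f s fs0 P b bil.
have [d [n snE]] := loc_common_denominator s.
have /= -> := snE _ _ (idfun : {linear N -> N}) _ bil.
pose c (q : loc_ring) (m : N') : loc_module N' :=
  frac ((rrep q : R * denom).1 *: m) (rrep q : R * denom).2.
have cE a t m : c (rfrac a t) m = frac (a *: m) t.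
  have [u [Wu]] := @rrep_cls frac_ring_setoid (a, t).
  rewrite /c /rfrac; case: (rrep _) => a' t' /= uE.
  apply/fracP; exists u; split=> //=; rewrite !scalerA.
  congr (_ *: _); exact: uE.
have c_bil : bilinear_act (fun r q => loc_map r * q) c.
  split.
  - elim/rfrac_ind=> a t; elim/rfrac_ind=> a' t' m.
    by rewrite rfracD !cE fracD !scalerA scalerDl.
  - by elim/rfrac_ind=> a t m m'; rewrite !cE scalerDr fracDl.
  - by move=> r; elim/rfrac_ind=> a t m; rewrite loc_mapM_frac !cE -fracZ scalerA.
  - by move=> r; elim/rfrac_ind=> a t m; rewrite !cE -fracZ !scalerA mulrC.
have := fs0 _ _ c_bil; rewrite big_map /= (snE _ _ _ _ c_bil) cE scale1r.
case/frac_eq0=> u [Wu]; rewrite -linearZ -(linear0 f) => /inj_f un0.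
case: bil => b1 b2 b3 b4.
have -> : rfrac 1 d = loc_map u * rfrac 1 (denomM (exist _ u Wu) d).
  by rewrite loc_mapM_frac; apply: rfracW => /=; ring.
by rewrite b3 -b4 un0 -(scale0r (0 : N)) b4 scale0r.
Qed.

End Localization.

(** * The prime spectrum *)

(** An ideal maximal among those that contain [J] and miss the multiplicative set [W] is prime. *)
Lemma prime_avoiding (R : comPzRingType) (J W : R -> Prop) :
  ideal J -> W 1 -> (forall a b, W a -> W b -> W (a * b)) ->
  (forall x, J x -> ~ W x) ->
  exists p, [/\ prime_ideal p, forall x, J x -> p x & forall x, p x -> ~ W x].
Proof.
move=> idJ W1 WM JW.
pose good (A : R -> Prop) := [/\ ideal A, forall x, J x -> A x & forall x, A x -> ~ W x].
pose P (A : set R) := A = set0 \/ good A.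
have goodP A x : P A -> A x -> good A by case=> // ->.
have [F FP Ftot|A [PA maxA]] := @Zorn_bigcup R P.
  have [[X FX [z Xz]]|Fempty] := pselect (exists2 X, F X & exists x, X x); last first.
    left; apply/seteqP; split=> // x [X FX Xx].
    by case: Fempty; exists X => //; exists x.
  have common x y : (\bigcup_(X in F) X)%classic x -> (\bigcup_(X in F) X)%classic y ->
      exists Y, [/\ F Y, good Y, Y x & Y y].
    move=> [Y FY Yx] [Z FZ Zy].
    have [YZ|ZY] := Ftot _ _ FY FZ.
      by exists Z; split=> //; [apply: goodP Zy; apply: FP | apply: YZ].
    by exists Y; split=> //; [apply: goodP Yx; apply: FP | apply: ZY].
  have [[X0 XB XM] JX XW] := goodP _ _ (FP _ FX) Xz.
  right; split.
  - split; first by exists X.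
      move=> x y Fx Fy; have [Y [FY [[_ YB _] _ _] Yx Yy]] := common x y Fx Fy.
      by exists Y => //; apply: YB.
    move=> r x Fx; have [Y [FY [[_ _ YM] _ _] Yx _]] := common x x Fx Fx.
    by exists Y => //; apply: YM.
  - by move=> x Jx; exists X => //; apply: JX.
  - by move=> x Fx; have [Y [_ [_ _ YW] Yx _]] := common x x Fx Fx; apply: YW.
have goodA : good A.
  (* The empty set is not maximal, as [J] is good and contains 0. *)
  case: PA => // A0; case: (maxA J); last by right; split.
  by rewrite A0; split=> // sub; have /sub : J 0 by case: idJ.
have [[A0 AB AM] JA AW] := goodA.
have AD x y : A x -> A y -> A (x + y).
  move=> Ax Ay; rewrite (_ : x + y = x - (0 - y)); last by ring.
  exact: AB (Ax) (AB _ _ A0 Ay).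
exists A; split=> //; split=> //; first by move/AW; apply.
(* By maximality [A + (a)] meets [W]. If neither a nor b is in [A] but a b is, the product of the
   two elements found in [W] lies in [A]. *)
have meets a : ~ A a -> exists x r, A x /\ W (x + r * a).
  move=> Aa; apply: contrapT => nW.
  apply: (maxA (fun z => exists x r, A x /\ z = x + r * a)).
    split; first by move=> x Ax; exists x, 0; rewrite mul0r addr0.
    by move/(_ a) => sub; apply/Aa/sub; exists 0, 1; rewrite mul1r add0r.
  right; split.
  - split; first by exists 0, 0; rewrite mul0r addr0.
      move=> _ _ [x [r [Ax ->]]] [y [s [Ay ->]]]; exists (x - y), (r - s).
      by split; [apply: AB | ring].
    move=> t _ [x [r [Ax ->]]]; exists (t * x), (t * r).
    by split; [apply: AM | ring].
  - by move=> x Jx; exists x, 0; rewrite mul0r addr0; split=> //; apply: JA.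
  - by move=> _ [x [r [Ax ->]]] Wx; apply: nW; exists x, r.
move=> a b Aab; apply: contrapT => /not_orP[/meets[x [r [Ax Wx]]] /meets[y [s [Ay Wy]]]].
apply: AW (WM _ _ Wx Wy).
rewrite (_ : _ * _ = (y + s * b) * x + ((r * a) * y + (r * s) * (a * b))); last by ring.
by apply: (AD); [apply: AM | apply: (AD); apply: (AM)].
Qed.

(** * Pi-regularity and the topologies on Spec(R) *)

Section Spectrum.
Variable R : comPzRingType.

(** Equivalently, f^n lies in f^(n+1) R: the descending chain of the ideals f^n R stabilizes. *)
Definition pi_regular : Prop := forall f : R, exists n a, f ^+ n * (1 - f * a) = 0.

Lemma prime_expr (p : R -> Prop) f n : prime_ideal p -> p (f ^+ n) -> p f.
Proof.
case=> _ p1 pM; elim: n => [|n IH]; first by rewrite expr0.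
by rewrite exprS => /pM[|/IH].
Qed.

Lemma prime_add1 (p : R -> Prop) x y : prime_ideal p -> p x -> p y -> x + y <> 1.
Proof.
move=> [[p0 pB pM] p1 _] px py xy; apply: p1; rewrite -xy -[y]opprK.
by apply: pB => //; rewrite -mulN1r; apply: pM.
Qed.

(** A prime p that avoids [W] would give a proper ideal p + (f): from 1 = x + r f with x in p, the
    element x = 1 - f r would be in [W]. Maximality then puts f in p, although f is in [W]. *)
Lemma maximal_pi_regular :
  (forall p : R -> Prop, prime_ideal p -> maximal_ideal p) -> pi_regular.
Proof.
move=> pmax f; apply: contrapT => nf.
pose W w := exists n a, w = f ^+ n * (1 - f * a).
have [|||x x0 [n [a xE]]|p [pp _ pW]] := @prime_avoiding R (fun x => x = 0) W.
- by split=> // [x y -> ->|r x ->]; rewrite ?subr0 ?mulr0.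
- by exists 0, 0; rewrite mulr0 subr0 mulr1.
(* The witness comes from (1 - f a)(1 - f b) = 1 - f (a + b - f a b). *)
- move=> _ _ [n [a ->]] [m [b ->]]; exists (n + m)%N, (a + b - f * a * b).
  by rewrite exprD; ring.
- by apply: nf; exists n, a; rewrite -xE.
have [[p0 pB pM] p1 _] := pp; have [_ _ maxp] := pmax p pp.
have pf : ~ p f by move/pW; apply; exists 1%N, 0; rewrite mulr0 subr0 mulr1.
apply: pf; apply: (maxp (fun z => exists x r, p x /\ z = x + r * f)).
- split; first by exists 0, 0; rewrite mul0r addr0.
    move=> _ _ [x [r [px ->]]] [y [s [py ->]]]; exists (x - y), (r - s).
    by split; [apply: pB | ring].
  by move=> t _ [x [r [px ->]]]; exists (t * x), (t * r); split; [apply: pM | ring].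
- move=> [x [r [px xE]]]; apply: (pW x px); exists 0%N, r.
  by rewrite xE; ring.
- by move=> x px; exists x, 0; rewrite mul0r addr0.
- by exists 0, 1; rewrite mul1r add0r.
Qed.

(** A proper ideal above p lies in a prime m, found as one that avoids 1; since m is minimal and
    contains p, it equals p. *)
Lemma minimal_maximal :
  (forall p : R -> Prop, prime_ideal p -> minimal_prime p) ->
  forall p : R -> Prop, prime_ideal p -> maximal_ideal p.
Proof.
move=> pmin p pp; have [idp p1 _] := pp; split=> // J idJ J1 pJ x Jx.
have [//|a b -> ->|y Jy y1|m [pm Jm _]] := @prime_avoiding R J (fun x => x = 1) idJ.
- by rewrite mulr1.
- by apply: J1; rewrite -y1.
have [_ /(_ p pp) minm] := pmin m pm; apply: (minm _ x (Jm x Jx)).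
by move=> y /pJ/Jm.
Qed.

(** This exchanges V(f) for D(g) and D(f) for V(g), so that patch-subbasic sets become Zariski or
    flat basic ones. *)
Lemma pi_regular_complement (f : R) : pi_regular ->
  exists g, forall p : R -> Prop, prime_ideal p -> p f <-> ~ p g.
Proof.
move=> /(_ f)[n [a fa]]; exists (1 - f * a) => p pp.
have [[p0 _ pM] p1 pP] := pp; split=> [pf pg|png].
  by apply: (prime_add1 (x := f * a) (y := 1 - f * a) pp); rewrite // 1?mulrC; [apply: pM|ring].
by have := p0; rewrite -fa => /pP[/(prime_expr pp)|/png].
Qed.

Lemma SpecP (x : Spec R) : prime_ideal (proj1_sig x).
Proof. exact: (proj2_sig x). Qed.

Lemma patch_open_D (f : R) : patch_open (fun x : Spec R => ~ proj1_sig x f).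
Proof.
move=> x xf; exists [:: (fun x : Spec R => ~ proj1_sig x f)]; split.
- by move=> A [<-|//]; exists f; left.
- by move=> A [<-|//].
- by move=> y /(_ _ (or_introl erefl)).
Qed.

Lemma patch_open_V (f : R) : patch_open (fun x : Spec R => proj1_sig x f).
Proof.
move=> x xf; exists [:: (fun x : Spec R => proj1_sig x f)]; split.
- by move=> A [<-|//]; exists f; right.
- by move=> A [<-|//].
- by move=> y /(_ _ (or_introl erefl)).
Qed.

Lemma flat_open_V (f : R) : flat_open (fun x : Spec R => proj1_sig x f).
Proof.
move=> x xf; exists (fun x : Spec R => proj1_sig x f); split=> //.
by exists [:: f] => y; split=> [yf r|]; [rewrite inE => /eqP -> | apply; rewrite inE].
Qed.

Lemma distinct_points (x y : Spec R) : ~ same_point x y -> exists r,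
  (proj1_sig x r /\ ~ proj1_sig y r) \/ (proj1_sig y r /\ ~ proj1_sig x r).
Proof.
move=> xy; apply: contrapT => nr; apply: xy => r.
by split=> xr; apply: contrapT => yr; apply: nr; exists r; [left|right].
Qed.

Lemma hausdorff_separating (O : (Spec R -> Prop) -> Prop) :
  (forall f, exists U V, [/\ O U, O V, forall x : Spec R, proj1_sig x f -> U x,
     forall x : Spec R, ~ proj1_sig x f -> V x & forall z, ~ (U z /\ V z)]) ->
  hausdorff O.
Proof.
move=> sep x y /distinct_points[f]; have [U [V [OU OV fU fV UV]]] := sep f.
case=> -[xf yf]; first by exists U, V; split; [| | apply: fU | apply: fV |].
exists V, U; split; [by [] | by [] | exact: fV | exact: fU |].
by move=> z [Vz Uz]; apply: (UV z).
Qed.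

(** V(f) and D(f) are complementary patch-open sets, whatever the ring; any topology equal to the
    patch topology is therefore Hausdorff. *)
Lemma patch_hausdorff : hausdorff (@patch_open R).
Proof.
apply: hausdorff_separating => f.
exists (fun x : Spec R => proj1_sig x f), (fun x : Spec R => ~ proj1_sig x f).
by split; [exact: patch_open_V | exact: patch_open_D | | | move=> z []].
Qed.

Lemma same_topology_hausdorff (O O' : (Spec R -> Prop) -> Prop) :
  same_topology O O' -> hausdorff O -> hausdorff O'.
Proof.
move=> OO' hO x y /hO[U [V [/OO' OU /OO' OV Ux Vy UV]]].
by exists U, V.
Qed.

(** The common part of the Zariski and flat cases: for q inside p, one of the two points lies in all
    neighbourhoods of the other, so a strict inclusion contradicts separation. That point is q for
    the Zariski topology and p for the flat one. *)
Lemma hausdorff_minimal (O : (Spec R -> Prop) -> Prop) : hausdorff O ->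
  (forall p q : Spec R, (forall r, proj1_sig q r -> proj1_sig p r) ->
     exists z : Spec R, (z = p \/ z = q) /\
       forall U V, O U -> O V -> U p -> V q -> U z /\ V z) ->
  forall p : R -> Prop, prime_ideal p -> minimal_prime p.
Proof.
move=> hO spec p pp; split=> // q pq qp x px; apply: contrapT => nqx.
have [/(_ x)/= [/(_ px) //]|U [V [OU OV Up Vq UV]]] :=
  hO (exist _ p pp) (exist _ q pq) _.
have [z [_ zUV]] := spec (exist _ p pp) (exist _ q pq) qp.
exact: (UV z) (zUV U V OU OV Up Vq).
Qed.

Lemma zariski_hausdorff_minimal : hausdorff (@zariski_open R) ->
  forall p : R -> Prop, prime_ideal p -> minimal_prime p.
Proof.
move=> hZ; apply: hausdorff_minimal hZ _ => p q qp.
exists q; split; first by right.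
move=> U V [E UE] _ /UE Up Vq; split=> //; apply/UE => Eq.
by apply: Up => r /Eq; apply: qp.
Qed.

Lemma flat_hausdorff_minimal : hausdorff (@flat_open R) ->
  forall p : R -> Prop, prime_ideal p -> minimal_prime p.
Proof.
move=> hF; apply: hausdorff_minimal hF _ => p q qp.
exists p; split; first by left.
move=> U V _ OV Up /OV[A [[l Al] Aq AV]]; split=> //.
by apply/AV/Al => r rl; apply: qp; apply: (Al q).1 rl.
Qed.

Lemma pi_regular_flat_hausdorff : pi_regular -> hausdorff (@flat_open R).
Proof.
move=> preg; apply: hausdorff_separating => f.
have [g fg] := pi_regular_complement f preg.
exists (fun x : Spec R => proj1_sig x f), (fun x : Spec R => proj1_sig x g).
split; [exact: flat_open_V | exact: flat_open_V | by [] | |].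
  by move=> x xf; apply: contrapT => /(fg _ (SpecP x)).
by move=> z [zf zg]; have [/(_ zf)] := fg _ (SpecP z).
Qed.

Lemma zariski_patch_open (U : Spec R -> Prop) : zariski_open U -> patch_open U.
Proof.
move=> [E UE] x /UE/existsNP[r /not_implyP[Er xr]].
have [l [lB lx lU]] := patch_open_D xr.
by exists l; split=> // y /lU yr; apply/UE => /(_ r Er).
Qed.

Lemma flat_patch_open (U : Spec R -> Prop) : flat_open U -> patch_open U.
Proof.
move=> OU x /OU[A [[l Al] /Al Ax AU]].
exists [seq (fun y : Spec R => proj1_sig y r) | r <- l]; split.
- elim: (l) => // r l' IH B /= [<-|/IH //]; exists r; right=> y.
  by split.
- elim: (l) Ax => // r l' IH lx B /= [<-|]; first by apply: lx; rewrite inE eqxx.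
  by apply: IH => s sl; apply: lx; rewrite inE sl orbT.
- move=> y ly; apply/AU/Al; elim: (l) ly => // r l' IH ly s.
  rewrite inE => /predU1P[->|]; first by apply: (ly (fun y => proj1_sig y r)); left.
  by apply: IH => B lB; apply: ly; right.
Qed.

(** Each subbasic neighbourhood of x contains some D(g) around x, with g = f or its complement; the
    product of finitely many such g gives a D(r) inside their intersection. *)
Lemma pi_regular_patch_zariski : pi_regular ->
  same_topology (@patch_open R) (@zariski_open R).
Proof.
move=> preg U; split; last exact: zariski_patch_open.
(* The family of all r with D(r) inside [U]: the claim is that these D(r) cover [U]. *)
move=> OU; exists (fun r => forall y : Spec R, ~ proj1_sig y r -> U y) => x.
split=> [/OU[l [lB lx lU]] xE|/existsNP[r /not_implyP[rU xr]]]; last exact: rU.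
have [r [xr rl]] : exists r, ~ proj1_sig x r /\
    forall y : Spec R, ~ proj1_sig y r -> forall A, List.In A l -> A y.
  elim: l lB lx {lU} => [|A l IH] lB lx.
    by exists 1; split=> // x1; have [_ []] := SpecP x.
  have [B lB'|B lB'|r [xr rl]] := IH; [by apply: lB; right|by apply: lx; right|].
  have [g [xg gA]] : exists g, ~ proj1_sig x g /\ forall y : Spec R, ~ proj1_sig y g -> A y.
    have Ax : A x by apply: lx; left.
    have [f [] AE] := lB A (or_introl erefl).
      by exists f; split=> [|y]; [exact: (AE x).1 Ax | exact: (AE y).2].
    have [g fg] := pi_regular_complement f preg.
    exists g; split=> [|y yg].
      by apply: (fg _ (SpecP x)).1; apply: (AE x).1 Ax.
    by apply: (AE y).2; apply: (fg _ (SpecP y)).2.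
  exists (g * r); split.
    by have [_ _ pP] := SpecP x; case/pP.
  move=> y ygr B; have [[_ _ yM] _ _] := SpecP y => -[<-|lB'].
    by apply: gA => yg; apply: ygr; rewrite mulrC; apply: yM.
  by apply: rl lB' => yr; apply: ygr; apply: yM.
by apply: xr; apply: xE => y yr; apply: lU; apply: rl.
Qed.

(** Dual to the Zariski case: sets V(g) replace D(g), and the elements g are collected in a list
    instead of multiplied. *)
Lemma pi_regular_patch_flat : pi_regular ->
  same_topology (@patch_open R) (@flat_open R).
Proof.
move=> preg U; split; last exact: flat_patch_open.
move=> OU x /OU[l [lB lx lU]].
have [s [xs sl]] : exists s : seq R, (forall r, r \in s -> proj1_sig x r) /\
    forall y : Spec R, (forall r, r \in s -> proj1_sig y r) -> forall A, List.In A l -> A y.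
  elim: l lB lx {lU} => [|A l IH] lB lx; first by exists [::].
  have [B lB'|B lB'|s [xs sl]] := IH; [by apply: lB; right|by apply: lx; right|].
  have [g [xg gA]] : exists g, proj1_sig x g /\ forall y : Spec R, proj1_sig y g -> A y.
    have Ax : A x by apply: lx; left.
    have [f [] AE] := lB A (or_introl erefl); last first.
      by exists f; split=> [|y]; [exact: (AE x).1 Ax | exact: (AE y).2].
    have [g fg] := pi_regular_complement f preg.
    exists g; split=> [|y yg].
      by apply: contrapT => /(fg _ (SpecP x)).2; apply: (AE x).1 Ax.
    by apply: (AE y).2 => /(fg _ (SpecP y)).1.
  exists (g :: s); split=> [r|y ygs B].
    by rewrite inE => /predU1P[->|/xs].
  case=> [<-|]; first by apply/gA/ygs; rewrite inE eqxx.
  by apply: sl => r rs; apply: ygs; rewrite inE rs orbT.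
exists (fun y => forall r, r \in s -> proj1_sig y r); split=> //; first by exists s.
by move=> y ys; apply: lU; apply: sl.
Qed.

End Spectrum.

(** * Nilpotents, and surjectivity of flat epimorphisms *)

Lemma nilpotentD (R : comPzRingType) (x y : R) :
  nilpotent x -> nilpotent y -> nilpotent (x + y).
Proof.
move=> [n xn] [m ym]; exists (n + m)%N; rewrite exprDn big1 // => i _.
have [im|mi] := leqP m i.
  by rewrite -(subnK im) [y ^+ _]exprD ym !mulr0 mul0rn.
have ni : (n <= n + m - i)%N by rewrite -addnBA ?leq_addr // ltnW.
by rewrite -(subnK ni) [x ^+ _]exprD xn mulr0 mul0r mul0rn.
Qed.

Lemma nilpotentMl (R : comPzRingType) (r x : R) : nilpotent x -> nilpotent (r * x).
Proof. by move=> [n xn]; exists n; rewrite exprMn xn mulr0. Qed.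

Lemma nilpotent_sum (R : comPzRingType) (I : eqType) (s : seq I) (F : I -> R) :
  (forall i, i \in s -> nilpotent (F i)) -> nilpotent (\sum_(i <- s) F i).
Proof.
move=> Fs; rewrite big_seq; elim/big_ind: _ => //; first by exists 1%N; rewrite expr1.
exact: nilpotentD.
Qed.

(** The counterpart of [vnr_local_unit] up to nilpotents: v is the product of the factors 1 - f a
    for f in [s], each congruent to 1 modulo [I]. *)
Lemma pi_regular_nil_unit (R : comPzRingType) (I : R -> Prop) (s : seq R) :
  pi_regular R -> ideal I -> (forall r, r \in s -> I r) ->
  exists v, I (1 - v) /\ forall r, r \in s -> nilpotent (r * v).
Proof.
move=> preg [I0 IB IM]; elim: s => [|f s IH] Is; first by exists 1; rewrite subrr.
have [r rs|v [Iv sv]] := IH; first by apply: Is; rewrite inE rs orbT.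
have [n [a fa]] := preg f; have If : I f by apply: Is; rewrite inE eqxx.
exists (v * (1 - f * a)); split.
  rewrite (_ : _ - _ = (1 - v) - (- (v * a)) * f); last by ring.
  by apply: IB => //; apply: IM.
move=> r; rewrite inE => /predU1P[->|/sv vr]; last first.
  by rewrite mulrA mulrC; apply: nilpotentMl.
(* The exponent is n + 1 because n may be 0: a factor 1 - f a must be present beside f^n. *)
rewrite mulrCA; apply: nilpotentMl; exists n.+1.
by rewrite exprMn !exprS [f * f ^+ n]mulrC mulrACA fa mul0r.
Qed.

Lemma pi_regular_flat_epi_surj (R S : comPzRingType) (phi : {rmorphism R -> S}) :
  pi_regular R -> flat_ringmorph phi -> ring_epi phi -> forall s, exists r, phi r = s.
Proof.
move=> preg flat_phi epi_phi s.
have [t [tI t1]] := denominator_generates s flat_phi epi_phi.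
have idI := denominator_ideal phi s.
have [r|v [Iv tv]] := pi_regular_nil_unit (s := unzip1 t) preg idI.
  by case/mapP=> x /tI xI ->.
(* Multiplying 1 = sum of phi(r_i) s_i by phi(v) makes each term a multiple of the nilpotent phi(r_i
   v). *)
have [n vn] : nilpotent (phi v).
  rewrite -[phi v]mul1r t1 mulr_suml; apply: nilpotent_sum => x xt.
  rewrite mulrAC mulrC -rmorphM; apply: nilpotentMl.
  have [|n xn] := tv x.1; first exact: map_f.
  by exists n; rewrite -rmorphXn xn rmorph0.
(* As phi(1 - v^n) = 1, this membership puts s itself in phi(R). *)
have [r rE] : denominator phi s (1 - v ^+ n).
  have [I0 IB IM] := idI; elim: n {vn} => [|n IH]; first by rewrite expr0 subrr.
  rewrite (_ : 1 - v ^+ n.+1 = (1 - v) - (- v) * (1 - v ^+ n)).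
    by apply: IB => //; apply: IM.
  by rewrite exprS; ring.
by exists r; rewrite -rE rmorphB rmorph1 rmorphXn vn subr0 mul1r.
Qed.

Lemma nilpotent_ideal (R : comPzRingType) : ideal (@nilpotent R).
Proof.
split; first by exists 1%N; rewrite expr1.
  move=> x y nx ny; apply: nilpotentD nx _.
  by rewrite -mulN1r; apply: nilpotentMl.
by move=> r x; apply: nilpotentMl.
Qed.

(** * The quotient by the nilradical *)

Section Reduced.
Variable R : comPzRingType.

Let nil_submodule := ideal_submodule (nilpotent_ideal R).

Program Definition reduced_setoid : ring_setoid :=
  @RingSetoid (quot_zmod_setoid nil_submodule) (1 : R) (fun x y : R => x * y) _ _ _ _ _.
Next Obligation.
move=> x x' y y' /= xx' yy'.
rewrite (_ : _ - _ = y * (x - x') + x' * (y - y') :> R); last by ring.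
by apply: nilpotentD; apply: nilpotentMl.
Qed.
Next Obligation. by move=> x y z /=; rewrite mulrA subrr; apply: submod0 nil_submodule. Qed.
Next Obligation. by move=> x y /=; rewrite [x * y]mulrC subrr; apply: submod0 nil_submodule. Qed.
Next Obligation. by move=> x /=; rewrite mul1r subrr; apply: submod0 nil_submodule. Qed.
Next Obligation. by move=> x y z /=; rewrite mulrDl subrr; apply: submod0 nil_submodule. Qed.

(** [reduced_quotient_absolutely_flat] ranges over all models of R/N; a concrete one is required to
    draw consequences from it. *)
Definition reduced : comPzRingType := rquot reduced_setoid.
Definition to_reduced (x : R) : reduced := @rcls reduced_setoid x.

Lemma to_reduced_zmod : zmod_morphism to_reduced.
Proof.
move=> x y; apply: (addIr (to_reduced y)); rewrite subrK.
by rewrite -(@rclsD reduced_setoid) /= subrK.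
Qed.

Lemma to_reduced_monoid : monoid_morphism to_reduced.
Proof. by split=> // x y; rewrite -(@rclsM reduced_setoid). Qed.

HB.instance Definition _ := GRing.isZmodMorphism.Build R reduced to_reduced to_reduced_zmod.
HB.instance Definition _ :=
  GRing.isMonoidMorphism.Build R reduced to_reduced to_reduced_monoid.

Lemma to_reduced_surj q : exists r, to_reduced r = q.
Proof. by elim/rquotW: q => x; exists x. Qed.

Lemma to_reduced_eq0 r : to_reduced r = 0 <-> nilpotent r.
Proof.
have := @rcls_eq0 reduced_setoid r.
by rewrite /= subr0.
Qed.

(** A relation f = f^2 a modulo nilpotents makes f (1 - f a) nilpotent, and (1 - f a)^n has the form
    1 - f b. *)
Lemma reduced_pi_regular : reduced_quotient_absolutely_flat R -> pi_regular R.
Proof.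
move=> /(_ reduced to_reduced to_reduced_surj to_reduced_eq0).
move/absolutely_flat_vnr=> vnr f; have [x fx] := vnr (to_reduced f).
have [a ax] := to_reduced_surj x; rewrite -{}ax in fx.
have /to_reduced_eq0[n fn] : to_reduced (f * (1 - f * a)) = 0.
  rewrite mulrBr mulr1 mulrA rmorphB !rmorphM /= -fx.
  exact: subrr.
have [b bE] : exists b, (1 - f * a) ^+ n = 1 - f * b.
  elim: n {fn} => [|n [b bE]]; first by exists 0; rewrite mulr0 subr0.
  by exists (a + b - f * a * b); rewrite exprS bE; ring.
by exists n, b; rewrite -bE -exprMn.
Qed.

End Reduced.

Lemma pi_regular_reduced (R : comPzRingType) :
  pi_regular R -> reduced_quotient_absolutely_flat R.
Proof.
move=> preg Q pi pi_surj pi_eq0; apply: vnr_absolutely_flat => q.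
have [f <-] := pi_surj q; have [n [a fa]] := preg f.
exists (pi a); apply/eqP; rewrite -!rmorphM -subr_eq0 -rmorphB; apply/eqP/pi_eq0.
exists n.+1; rewrite (_ : f - f * f * a = f * (1 - f * a)); last by ring.
by rewrite exprMn !exprS [f * f ^+ n]mulrC mulrACA fa mul0r.
Qed.

(** * Localization at a prime, and the cycle of implications *)

Lemma flat_epi_loc_surjective (R : comPzRingType) (p : R -> Prop) :
  (forall (S : comPzRingType) (phi : {rmorphism R -> S}),
     flat_ringmorph phi -> ring_epi phi -> forall s : S, exists r, phi r = s) ->
  prime_ideal p -> loc_map_surjective p.
Proof.
move=> surj [_ p1 pM] [a s] /= ps.
have WM x y : ~ p x -> ~ p y -> ~ p (x * y) by move=> px py /pM[].
have [b] := surj _ (loc_map p1 WM) (@loc_map_flat _ _ p1 WM) (@loc_map_epi _ _ p1 WM)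
  (rfrac p1 WM a (exist _ s ps)).
case/rfracP=> u [pu /= uE]; exists b, u; split=> //=.
by rewrite mulrBr -uE subrr.
Qed.

(** If x is outside p, the fraction 1/x equals some a/1, so 1 - a x is in p; an ideal that contains
    both p and x thus contains 1. *)
Lemma loc_surjective_maximal (R : comPzRingType) (p : R -> Prop) :
  prime_ideal p -> loc_map_surjective p -> maximal_ideal p.
Proof.
move=> pp surj; have [[p0 pB pM] p1 pP] := pp.
split=> // J [J0 JB JM] J1 pJ x Jx; apply: contrapT => px.
have [a [t [pt]]] := surj (1, x) px; rewrite /= mulr1 => tE.
apply: J1; rewrite (_ : 1 = 1 - a * x - (0 - a * x)); last by ring.
have p1ax : p (1 - a * x) by have := p0; rewrite -tE => /pP[].
exact: JB (pJ _ p1ax) (JB _ _ J0 (JM _ _ Jx)).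
Qed.

Theorem theorem4p7 (R : comPzRingType) :
  [<-> reduced_quotient_absolutely_flat R;
       forall (S : comPzRingType) (phi : {rmorphism R -> S}),
         flat_ringmorph phi -> ring_epi phi -> forall s : S, exists r, phi r = s;
       forall p : R -> Prop, prime_ideal p -> loc_map_surjective p;
       forall p : R -> Prop, prime_ideal p -> maximal_ideal p;
       same_topology (@patch_open R) (@zariski_open R);
       hausdorff (@zariski_open R);
       forall p : R -> Prop, prime_ideal p -> minimal_prime p;
       hausdorff (@flat_open R);
       same_topology (@patch_open R) (@flat_open R)].
Proof.
(* The last three implications of the cycle all return to pi-regularity through the minimality of
   primes. *)
have pi_max : (forall p : R -> Prop, prime_ideal p -> minimal_prime p) -> pi_regular R.
  by move=> pmin; apply/maximal_pi_regular/minimal_maximal.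
tfae.
- by move=> /reduced_pi_regular preg S phi; apply: pi_regular_flat_epi_surj.
- by move=> surj p pp; apply: flat_epi_loc_surjective.
- by move=> surj p pp; apply: loc_surjective_maximal (surj p pp).
- by move=> /maximal_pi_regular; apply: pi_regular_patch_zariski.
- by move=> pZ; apply: same_topology_hausdorff pZ (@patch_hausdorff R).
- exact: zariski_hausdorff_minimal.
- by move/pi_max; apply: pi_regular_flat_hausdorff.
- by move/flat_hausdorff_minimal/pi_max; apply: pi_regular_patch_flat.
- move=> pF; apply/pi_regular_reduced/pi_max/flat_hausdorff_minimal.
  exact: same_topology_hausdorff pF (@patch_hausdorff R).
Qed.
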